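(* Let $\varepsilon$ and $\varepsilon'$ be admissible graded contractions of a very good $\mathbb{Z}_2^3$-grading $\Gamma$ on a complex Lie algebra $\mathfrak{L}$, with supports $\mathcal{S}^\varepsilon$ and $\mathcal{S}^{\varepsilon'}$. Then: (a) If $\varepsilon\sim\varepsilon'$, there is a collineation $\sigma$ with $\sigma\cdot\varepsilon\approx\varepsilon'$, except possibly if $\mathcal{S}^\varepsilon=X^{(i)}$ or $\mathcal{S}^\varepsilon\subseteq X_{(i)}$ for some $i\in I$. In case $\Gamma=\Gamma_{\mathfrak{b}_3}$ or $\Gamma=\Gamma_{\mathfrak{d}_4}$: (b) If $\varepsilon\sim\varepsilon'$ and $\mathcal{S}^\varepsilon\not\sim_c\mathcal{S}^{\varepsilon'}$, then there are distinct $i,j,k\in I$, not forming a line, such that $\mathcal{S}^\varepsilon$ and $\mathcal{S}^{\varepsilon'}$ are the two sets $\{\{i,j\},\{i,k\},\{i,j*k\}\}$ and $\{\{i,j\},\{i,k\},\{i,i*j*k\}\}$. (c) If $\varepsilon\sim\varepsilon'$ and $\mathcal{S}^\varepsilon\sim_c\mathcal{S}^{\varepsilon'}$, then there is a collineation $\sigma$ with $\sigma\cdot\varepsilon\approx\varepsilon'$.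
   Context: **Combinatorics.** $I=\{1,\dots,7\}$; the lines of the Fano plane are $\mathbf{L}=\{(1,2,5),(5,6,7),(7,4,1),(1,3,6),(6,4,2),(2,7,3),(3,4,5)\}$. For $i\ne j$ in $I$, $i*j$ is the third point on the line through $i,j$. (If $i,j,k$ are distinct and not on a line, $i*j*k:=(i*j)*k=i*(j*k)$.) $X=\{\{i,j\}:1\le i<j\le7\}$, $X_{(i)}=\{\gamma\in X:i\in\gamma\}$, $X^{(i)}=\{\{j,k\}\in X:j*k=i\}$. A collineation is a bijection $\sigma\colon I\to I$ with $\sigma(i*j)=\sigma(i)*\sigma(j)$ for all $i\neq j$. For $T,T'\subseteq X$, $T\sim_c T'$ (collinear) means $\sigma(T)=T'$ for some collineation $\sigma$. **Gradings.** $G=\mathbb{Z}_2^3$ with neutral element $e$ and elements $g_0=(0,0,0)=e$, $g_1=(1,0,0)$, $g_2=(0,1,0)$, $g_3=(0,0,1)$, $g_4=(1,1,1)$, $g_5=(1,1,0)$, $g_6=(1,0,1)$, $g_7=(0,1,1)$, so $g_i+g_j=g_{i*j}$ for $i\neq j\in I$. A $G$-grading $\Gamma:\mathfrak{L}=\bigoplus_{g\in G}\mathfrak{L}_g$ on a complex Lie algebra is good if (i) $\mathfrak{L}_e=0$; (ii) $[\mathfrak{L}_g,\mathfrak{L}_h]=\mathfrak{L}_{g+h}$ for all $g\ne h$ in $G\setminus\{e\}$; (iii) if $\langle g,h,k\rangle=G$ there are $x\in\mathfrak{L}_g,y\in\mathfrak{L}_h,z\in\mathfrak{L}_k$ with $[x,[y,z]],[y,[z,x]]$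 linearly independent. It is very good if moreover its Weyl group $\mathrm{Aut}(\Gamma)/\mathrm{Stab}(\Gamma)$ is isomorphic to $\mathrm{Aut}(\mathbb{Z}_2^3)$, where $\mathrm{Aut}(\Gamma)$ is the group of automorphisms of $\mathfrak{L}$ permuting the homogeneous components and $\mathrm{Stab}(\Gamma)$ the subgroup of those preserving each component (so every automorphism of $G$ is induced by an automorphism of $\mathfrak{L}$). **$\Gamma_{\mathfrak{b}_3},\Gamma_{\mathfrak{d}_4}$** (these are very good). $\mathcal{O}$ is the complex octonion algebra with basis $e_0=1,e_1,\dots,e_7$, $e_i^2=-1$ for $i\neq 0$, and $e_ie_j=-e_je_i=e_k$ whenever $(i,j,k)$ is a cyclic permutation of an element of $\mathbf{L}$; $n$ is the symmetric bilinear form with $n(e_i,e_j)=\delta_{ij}$; $\mathcal{O}_{g_i}=\mathbb{C}e_i$. $\mathfrak{d}_4=\mathfrak{so}(\mathcal{O},n)$, $\mathfrak{b}_3=\{f\in\mathfrak{d}_4:f(1)=0\}$, and for $\mathfrak{L}$ either of these, $\Gamma_{\mathfrak{L}}$ has components $\mathfrak{L}_g=\{f\in\mathfrak{L}: f(\mathcal{O}_h)\subseteq\mathcal{O}_{g+h}\ \forall h\in G\}$. **Graded contractions.** A graded contraction of $\Gamma$ is a map $\varepsilon\colon G\times G\to\mathbb{C}$ such that $\mathfrak{L}$ with product $[x,y]^\varepsilon:=\varepsilon(g,h)[x,y]$ ($x\in\mathfrak{L}_g$, $y\in\mathfrak{L}_h$) is a Lie algebra, denoted $\mathfrak{L}^\varepsilon$.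 It is admissible if $\varepsilon(g,g)=\varepsilon(e,g)=\varepsilon(g,e)=0$ for all $g$; admissible graded contractions of good gradings are symmetric, so they are determined by the values $\varepsilon_{ij}=\varepsilon(g_i,g_j)$ for $\{i,j\}\in X$. The support is $\mathcal{S}^\varepsilon=\{\{i,j\}\in X:\varepsilon_{ij}\neq0\}$. $\varepsilon\sim\varepsilon'$ means there is a Lie algebra isomorphism $f\colon\mathfrak{L}^\varepsilon\to\mathfrak{L}^{\varepsilon'}$ such that for each $g$ there is $h$ with $f(\mathfrak{L}_g)=\mathfrak{L}_h$; $\varepsilon\approx\varepsilon'$ means there is one with $f(\mathfrak{L}_g)=\mathfrak{L}_g$ for all $g$. For a collineation $\sigma$, $\sigma\cdot\varepsilon$ is the admissible map with $(\sigma\cdot\varepsilon)_{ij}=\varepsilon_{\sigma(i)\sigma(j)}$.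
   Formalization: In (b) the supports cannot in general be the two sets for the same i,j,k, since ε' may be replaced by σ·ε' for any collineation σ; the formal claim is that S^ε is one of the two sets and S^ε' is collinear to the other. *)

(* Defs.v *)
From HB Require Import structures.
From mathcomp Require Import all_boot all_order all_algebra all_fingroup.
From mathcomp Require Import boolp classical_sets reals.
From mathcomp Require Import complex.
From mathcomp Require Import ring.

Set Implicit Arguments.
Unset Strict Implicit.
Unset Printing Implicit Defensive.

Import GRing.Theory.

Local Open Scope ring_scope.

(* 'I_7 = {0,...,6}, so the ordinal i encodes the element lab i = i + 1 of
   {1,...,7}. *)
Notation I := 'I_7.

Definition lab (i : I) : nat := i.+1.

Definition fano_lines : seq (seq nat) :=
  [:: [:: 1; 2; 5]; [:: 5; 6; 7]; [:: 7; 4; 1]; [:: 1; 3; 6];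
      [:: 6; 4; 2]; [:: 2; 7; 3]; [:: 3; 4; 5]]%N.

Definition on_line (i j k : I) : bool :=
  has (perm_eq [:: lab i; lab j; lab k]) fano_lines.

(* star i j is i * j; the value star i i = i is junk. *)
Definition star (i j : I) : I := odflt i [pick k | on_line i j k].

Definition X : {set {set I}} := [set c : {set I} | #|c| == 2%N].
Definition X_lower (i : I) : {set {set I}} := [set c in X | i \in c].
Definition X_upper (i : I) : {set {set I}} :=
  [set c in X | [exists j : I, exists k : I, (c == [set j; k]) && (star j k == i)]].

Definition collineation (s : {perm I}) : Prop :=
  forall i j : I, i != j -> s (star i j) = star (s i) (s j).

Definition collinear (T T' : {set {set I}}) : Prop :=
  exists2 s : {perm I}, collineation s & [set s @: (c : {set I}) | c in T] = T'.

Definition triple_line (i j k : I) : {set {set I}} :=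
  [set [set i; j]; [set i; k]; [set i; star j k]].
Definition triple_gen (i j k : I) : {set {set I}} :=
  [set [set i; j]; [set i; k]; [set i; star (star i j) k]].

(* The finGroupType law of this product type is its addition. *)
Definition G : Type := ('Z_2 * 'Z_2 * 'Z_2)%type.
HB.instance Definition _ := GRing.Zmodule.on G.
HB.instance Definition _ := FinGroup.on G.

Definition gvec (m : nat) : G :=
  nth 0 [:: (0, 0, 0); (1, 0, 0); (0, 1, 0); (0, 0, 1);
            (1, 1, 1); (1, 1, 0); (1, 0, 1); (0, 1, 1)] m.

Definition gI (i : I) : G := gvec (lab i).

Section Lie.
Variable C : fieldType.

Record is_lie_bracket (L : lmodType C) (br : L -> L -> L) : Prop := IsLieBracket {
  lie_linl : forall (a : C) x y z, br (a *: x + y) z = a *: br x z + br y z;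
  lie_linr : forall (a : C) x y z, br x (a *: y + z) = a *: br x y + br x z;
  lie_alt  : forall x, br x x = 0;
  lie_jac  : forall x y z, br x (br y z) + br y (br z x) + br z (br x y) = 0 }.

Record lieAlgebra := LieAlgebra {
  lie_sort :> lmodType C;
  lie_br : lie_sort -> lie_sort -> lie_sort;
  lie_axioms : is_lie_bracket lie_br }.

Record is_lie_iso (L : lmodType C) (br br' : L -> L -> L) (f : L -> L) : Prop :=
  IsLieIso {
    lie_iso_linear : linear f;
    lie_iso_bij : bijective f;
    lie_iso_br : forall x y, f (br x y) = br' (f x) (f y) }.

Record is_subspace (L : lmodType C) (A : set L) : Prop := IsSubspace {
  subspace0 : A 0;
  subspaceP : forall (a : C) x y, A x -> A y -> A (a *: x + y) }.

Definition bracket_span (L : lieAlgebra) (A B : set L) : set L :=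
  fun x => exists (n : nat) (c : 'I_n -> C) (a b : 'I_n -> L),
    (forall k, A (a k) /\ B (b k)) /\ x = \sum_(k < n) c k *: lie_br (a k) (b k).

Definition lin_indep2 (L : lmodType C) (x y : L) : Prop :=
  forall a b : C, a *: x + b *: y = 0 -> a = 0 /\ b = 0.

(* Data only: nothing here forces the family to be a grading, see is_grading. *)
Record gradedLieAlgebra := GradedLieAlgebra {
  gla_alg :> lieAlgebra;
  gla_comp : G -> set gla_alg }.

Definition decomposes (Gam : gradedLieAlgebra) (x : Gam) (u : {ffun G -> Gam}) :
    Prop :=
  (forall g, gla_comp g (u g)) /\ x = \sum_g u g.

Record is_grading (Gam : gradedLieAlgebra) : Prop := IsGrading {
  grading_sub : forall g, is_subspace (@gla_comp Gam g);
  grading_direct : forall x : Gam, exists! u, decomposes x u;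
  grading_br : forall g h (x y : Gam),
    gla_comp g x -> gla_comp h y -> gla_comp (g + h) (lie_br x y) }.

Record good (Gam : gradedLieAlgebra) : Prop := Good {
  good_grading : is_grading Gam;
  good_e : @gla_comp Gam 0 = [set 0]%classic;
  good_br : forall g h : G, g != h -> g != 0 -> h != 0 ->
    bracket_span (@gla_comp Gam g) (@gla_comp Gam h) = @gla_comp Gam (g + h);
  good_gen : forall g h k : G, <<[set g; h; k]>>%g = [set: G] ->
    exists x y z : Gam,
      [/\ gla_comp g x, gla_comp h y, gla_comp k z &
          lin_indep2 (lie_br x (lie_br y z)) (lie_br y (lie_br z x))] }.

Definition permutes_components (Gam : gradedLieAlgebra) (f : Gam -> Gam) : Prop :=
  forall g, exists h, (f @` gla_comp g)%classic = gla_comp h.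

Definition preserves_components (Gam : gradedLieAlgebra) (f : Gam -> Gam) : Prop :=
  forall g, (f @` gla_comp g)%classic = gla_comp g.

Definition is_aut (Gam : gradedLieAlgebra) (f : Gam -> Gam) : Prop :=
  is_lie_iso (@lie_br Gam) (@lie_br Gam) f.

Definition in_Aut (Gam : gradedLieAlgebra) (f : Gam -> Gam) : Prop :=
  is_aut f /\ permutes_components f.

Definition in_Stab (Gam : gradedLieAlgebra) (f : Gam -> Gam) : Prop :=
  is_aut f /\ preserves_components f.

(* Aut(Gam) / Stab(Gam) is isomorphic to Aut(Z_2^3): the isomorphism is given
   as a surjective group morphism phi on Aut(Gam) with kernel Stab(Gam). In
   {perm G}, s * t means "first s, then t". *)
Definition weyl_isog_AutG (Gam : gradedLieAlgebra) : Prop :=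
  exists phi : (Gam -> Gam) -> {perm G},
    [/\ forall f, in_Aut f -> phi f \in Aut [set: G],
        forall f f', in_Aut f -> in_Aut f' -> phi (f \o f') = (phi f' * phi f)%g,
        forall a, a \in Aut [set: G] -> exists2 f, in_Aut f & phi f = a &
        forall f, in_Aut f -> (phi f = 1%g <-> in_Stab f)].

Definition very_good (Gam : gradedLieAlgebra) : Prop :=
  good Gam /\ weyl_isog_AutG Gam.

(* Meaningful only when Gam is a grading (0 if x has no decomposition). *)
Definition components (Gam : gradedLieAlgebra) (x : Gam) : {ffun G -> Gam} :=
  xget 0 (decomposes x).

(* The bilinear extension of [x, y]^eps = eps(g, h) [x, y] for x in L_g and
   y in L_h. *)
Definition contracted_br (Gam : gradedLieAlgebra) (eps : G -> G -> C)
    (x y : Gam) : Gam :=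
  \sum_g \sum_h eps g h *: lie_br (components x g) (components y h).

Definition graded_contraction (Gam : gradedLieAlgebra) (eps : G -> G -> C) :
    Prop :=
  is_lie_bracket (@contracted_br Gam eps).

Definition admissible (eps : G -> G -> C) : Prop :=
  forall g, [/\ eps g g = 0, eps 0 g = 0 & eps g 0 = 0].

Definition contraction_support (eps : G -> G -> C) : {set {set I}} :=
  [set c in X | [exists i : I, exists j : I,
    (c == [set i; j]) && (eps (gI i) (gI j) != 0)]].

Definition sim (Gam : gradedLieAlgebra) (eps eps' : G -> G -> C) : Prop :=
  exists2 f : Gam -> Gam,
    is_lie_iso (contracted_br eps) (contracted_br eps') f &
    permutes_components f.

Definition approx (Gam : gradedLieAlgebra) (eps eps' : G -> G -> C) : Prop :=
  exists2 f : Gam -> Gam,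
    is_lie_iso (contracted_br eps) (contracted_br eps') f &
    preserves_components f.

Definition idx (g : G) : option I := [pick i : I | gI i == g].

Definition coll_act (s : {perm I}) (eps : G -> G -> C) : G -> G -> C :=
  fun g h =>
    match idx g, idx h with
    | Some i, Some j => if i == j then 0 else eps (gI (s i)) (gI (s j))
    | _, _ => 0
    end.

(* Only the graded space underlying the octonions and the form n matter below,
   so the octonion product is not introduced. *)
Definition Oct : vectType C := 'rV[C]_8.

Definition oct_e (i : 'I_8) : Oct := delta_mx 0 i.

Definition oct_n (x y : Oct) : C := \sum_(i < 8) (x : 'rV_8) 0 i * (y : 'rV_8) 0 i.

Definition oct_comp (g : G) : set Oct :=
  fun x => exists (i : 'I_8) (c : C), gvec i = g /\ x = c *: oct_e i.

Definition commutator (f g : 'End(Oct)) : 'End(Oct) := ((f \o g) - (g \o f))%VF.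

Record lieSubalgebra := LieSubalgebra {
  lsa_mem : {pred 'End(Oct)};
  lsa_submod : submod_closed lsa_mem;
  lsa_commutator :
    forall f g, f \in lsa_mem -> g \in lsa_mem -> commutator f g \in lsa_mem }.

HB.instance Definition _ (A : lieSubalgebra) :=
  GRing.isSubmodClosed.Build C 'End(Oct) (lsa_mem A) (lsa_submod A).

Record lsa_type (A : lieSubalgebra) :=
  LsaType { lsa_val : 'End(Oct); _ : lsa_val \in lsa_mem A }.

HB.instance Definition _ A := [isSub for @lsa_val A].
HB.instance Definition _ A := [Choice of lsa_type A by <:].
HB.instance Definition _ A := [SubChoice_isSubLmodule of lsa_type A by <:].

Definition lsa_br (A : lieSubalgebra) (f g : lsa_type A) : lsa_type A :=
  LsaType (lsa_commutator (valP f) (valP g)).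

Lemma commutator_linl (a : C) (f g h : 'End(Oct)) :
  commutator (a *: f + g) h = a *: commutator f h + commutator g h.
Proof.
rewrite /commutator comp_lfunDl comp_lfunDr -comp_lfunZl -comp_lfunZr.
by rewrite scalerBr opprD addrACA.
Qed.

Lemma commutatorC (f g : 'End(Oct)) : commutator f g = - commutator g f.
Proof. by rewrite /commutator opprB. Qed.

Lemma commutator_linr (a : C) (f g h : 'End(Oct)) :
  commutator f (a *: g + h) = a *: commutator f g + commutator f h.
Proof.
by rewrite commutatorC commutator_linl opprD -scalerN -!commutatorC.
Qed.

Lemma commutator_jac (f g h : 'End(Oct)) :
  commutator f (commutator g h) + commutator g (commutator h f) +
  commutator h (commutator f g) = 0.
Proof.
apply/lfunP=> x; rewrite /commutator !(add_lfunE, opp_lfunE, comp_lfunE) lfunE /=.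
by rewrite !linearB /=; apply/rowP => k; rewrite !mxE; ring.
Qed.

Lemma lsa_lie (A : lieSubalgebra) : is_lie_bracket (@lsa_br A).
Proof.
split.
- by move=> a x y z; apply: val_inj; rewrite /= commutator_linl.
- by move=> a x y z; apply: val_inj; rewrite /= commutator_linr.
- by move=> x; apply: val_inj; rewrite /= /commutator subrr.
- by move=> x y z; apply: val_inj; rewrite /= commutator_jac.
Qed.

Definition lsa_algebra (A : lieSubalgebra) : lieAlgebra := LieAlgebra (lsa_lie A).

Definition so_graded (A : lieSubalgebra) : gradedLieAlgebra :=
  @GradedLieAlgebra (lsa_algebra A) (fun g (f : lsa_type A) =>
    forall h x, oct_comp h x -> oct_comp (g + h) (lsa_val f x)).

Lemma oct_n_linl (a : C) (x y z : Oct) :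
  oct_n (a *: x + y) z = a * oct_n x z + oct_n y z.
Proof.
rewrite /oct_n mulr_sumr -big_split; apply: eq_bigr => i _ /=.
by rewrite !mxE mulrDl mulrA.
Qed.

Lemma oct_n_linr (a : C) (x y z : Oct) :
  oct_n x (a *: y + z) = a * oct_n x y + oct_n x z.
Proof.
rewrite /oct_n mulr_sumr -big_split; apply: eq_bigr => i _ /=.
by rewrite !mxE mulrDr mulrCA.
Qed.

Definition d4_mem : {pred 'End(Oct)} :=
  [pred f : 'End(Oct) | `[< forall x y, oct_n (f x) y = - oct_n x (f y) >]].

Lemma d4_submod : submod_closed d4_mem.
Proof.
have n0l (x : Oct) : oct_n 0 x = 0.
  by rewrite /oct_n big1 // => i _; rewrite mxE mul0r.
have n0r (x : Oct) : oct_n x 0 = 0.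
  by rewrite /oct_n big1 // => i _; rewrite mxE mulr0.
split.
  by rewrite inE => x y; rewrite !zero_lfunE n0l n0r oppr0.
move=> a f g; rewrite !inE => Hf Hg x y.
by rewrite !add_lfunE !scale_lfunE oct_n_linl oct_n_linr Hf Hg mulrN opprD.
Qed.

Lemma d4_commutator (f g : 'End(Oct)) :
  f \in d4_mem -> g \in d4_mem -> commutator f g \in d4_mem.
Proof.
rewrite !inE => Hf Hg x y.
rewrite /commutator !add_lfunE !opp_lfunE !comp_lfunE.
rewrite -!scaleN1r ![_ + -1 *: _]addrC oct_n_linl oct_n_linr !Hf !Hg !Hf.
by ring.
Qed.

Definition d4 : lieSubalgebra := LieSubalgebra d4_submod d4_commutator.

Definition b3_mem : {pred 'End(Oct)} :=
  [pred f : 'End(Oct) | (f \in d4_mem) && (f (oct_e 0) == 0)].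

Lemma b3_submod : submod_closed b3_mem.
Proof.
have [d40 d4P] := d4_submod; split.
  by apply/andP; rewrite d40 zero_lfunE eqxx.
move=> a f g /andP[Hf /eqP f0] /andP[Hg /eqP g0]; apply/andP.
by rewrite d4P // add_lfunE scale_lfunE f0 g0 scaler0 addr0 eqxx.
Qed.

Lemma b3_commutator (f g : 'End(Oct)) :
  f \in b3_mem -> g \in b3_mem -> commutator f g \in b3_mem.
Proof.
move=> /andP[Hf /eqP f0] /andP[Hg /eqP g0]; apply/andP.
rewrite d4_commutator // /commutator add_lfunE opp_lfunE !comp_lfunE f0 g0.
by rewrite !linear0 addr0 eqxx.
Qed.

Definition b3 : lieSubalgebra := LieSubalgebra b3_submod b3_commutator.

Definition Gamma_d4 : gradedLieAlgebra := so_graded d4.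
Definition Gamma_b3 : gradedLieAlgebra := so_graded b3.

End Lie.

(* Main.v *)
(* The seven points of the Fano plane are identified with the nonzero elements of
   G = Z_2^3, so that i * j becomes g + h and collineations become additive permutations.

   An equivalence f : L^eps -> L^eps' permutes the degrees by some p, and p is additive on
   every line carrying a pair of the support. As soon as two such lines meet at i, p agrees
   with an additive permutation s on these two lines, and any further line not through i
   forces p = s on the remaining points. Hence either p agrees with a collineation on all
   degrees that matter, and f can be glued with an automorphism inducing it, or the support
   lives exactly on the three lines through a point i; the Jacobi identity then leaves only
   X^(i) or a subset of X_(i).

   Inside X^(i), all values can be rescaled to 1. Inside X_(i), up to rescaling only the
   ratios of the products eps_{i,g} eps_{i,i+g} matter. For so(7) and so(8) these ratios are
   invariant: some x in L_i satisfies ad(x)^2 = -1 on two lines through i at once, and for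
   z in L_i with coordinates a, b, c, d, if ad(z)^2 is the scalar -q on one line and -q' on
   the other, then q + q = a^2 + b^2 + c^2 + d^2 = q' + q', whence q = q'. *)
From HB Require Import structures.
Require Import Defs.
From mathcomp Require Import all_boot all_order all_algebra all_fingroup.
From mathcomp Require Import boolp classical_sets reals complex.
From mathcomp Require Import ring.
Set Implicit Arguments.
Unset Strict Implicit.
Unset Printing Implicit Defensive.
Import GRing.Theory.
Local Open Scope ring_scope.

(** * Linear algebra of Z_2^3 *)

(** An explicit list, so that [vm_compute] can decide boolean statements quantified over [G]. *)
Definition enumG : seq G := [seq gvec m | m <- iota 0 8].

Lemma forallG (P : pred G) : all P enumG -> forall g, P g.
Proof.
move=> /allP H g; apply: H; case: g => [[x y] z].
by move: x y z; do 3 (case; case=> [|[|//]] ?); vm_compute.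
Qed.

Lemma forallG2 (P : G -> G -> bool) :
  all (fun g => all (P g) enumG) enumG -> forall g h, P g h.
Proof. by move=> H g; apply: forallG; apply: (forallG H). Qed.

Lemma forallG3 (P : G -> G -> G -> bool) :
  all (fun g => all (fun h => all (P g h) enumG) enumG) enumG ->
  forall g h k, P g h k.
Proof. by move=> H g; apply: forallG2; apply: (forallG H). Qed.

Lemma forallG4 (P : G -> G -> G -> G -> bool) :
  all (fun g => all (fun h => all (fun k => all (P g h k) enumG) enumG) enumG)
    enumG ->
  forall g h k l, P g h k l.
Proof. by move=> H g; apply: forallG3; apply: (forallG H). Qed.

Lemma forallG5 (P : G -> G -> G -> G -> G -> bool) :
  all (fun a => all (fun g => all (fun h => all (fun k => all (P a g h k) enumG)
    enumG) enumG) enumG) enumG ->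
  forall a g h k l, P a g h k l.
Proof. by move=> H g; apply: forallG4; apply: (forallG H). Qed.

Lemma addgg (g : G) : g + g = 0.
Proof. by apply/eqP; apply: (@forallG (fun g => g + g == 0)); vm_compute. Qed.

Lemma addgK (g h : G) : g + (g + h) = h.
Proof. by rewrite addrA addgg add0r. Qed.

Lemma addg_eq0 (g h : G) : (g + h == 0) = (g == h).
Proof. by rewrite -(inj_eq (addrI g)) addgK addr0 eq_sym. Qed.

(** A basis of Z_2^3, each vector lying outside the span of the earlier ones; in the Fano plane,
    three points not on a line. *)
Definition independent3 (i a b : G) : bool :=
  [&& i != 0, a \notin [:: 0; i] & b \notin [:: 0; i; a; i + a]].

Lemma span3 (i a b g : G) : independent3 i a b ->
  g \in [:: 0; i; a; b; i + a; i + b; a + b; i + (a + b)].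
Proof.
apply/implyP; move: i a b g.
by apply: (@forallG4 (fun i a b g => independent3 i a b ==>
  (g \in [:: 0; i; a; b; i + a; i + b; a + b; i + (a + b)]))); vm_compute.
Qed.

Lemma independent3_rot (i a b : G) : independent3 i a b -> independent3 a b i.
Proof.
apply/implyP; move: i a b.
by apply: (@forallG3 (fun i a b => independent3 i a b ==> independent3 a b i));
  vm_compute.
Qed.

Lemma independent3_swap (i a b : G) : independent3 i a b -> independent3 i b a.
Proof.
apply/implyP; move: i a b.
by apply: (@forallG3 (fun i a b => independent3 i a b ==> independent3 i b a));
  vm_compute.
Qed.

Lemma independent3_ex (i a : G) : i != 0 -> a \notin [:: 0; i] ->
  exists b, independent3 i a b.
Proof.
move=> i0 a0; suff /hasP[b _ Hb] : has (independent3 i a) enumG by exists b.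
move: a0; apply/implyP; move: i0; apply/implyP; move: i a.
by apply: (@forallG2 (fun i a => _ ==> _)); vm_compute.
Qed.

Lemma generated_independent3 (i a b : G) : independent3 i a b ->
  (<<[set i; a; b]>>)%g = [set: G].
Proof.
move=> H; apply/setP=> g; rewrite inE.
have Hi : i \in (<<[set i; a; b]>>)%g by rewrite mem_gen // !inE eqxx.
have Ha : a \in (<<[set i; a; b]>>)%g by rewrite mem_gen // !inE eqxx ?orbT.
have Hb : b \in (<<[set i; a; b]>>)%g by rewrite mem_gen // !inE eqxx ?orbT.
have D g1 g2 : g1 \in (<<[set i; a; b]>>)%g -> g2 \in (<<[set i; a; b]>>)%g ->
  g1 + g2 \in (<<[set i; a; b]>>)%g by apply: groupM.
have := span3 g H; rewrite !inE => /or4P[/eqP->|/eqP->|/eqP->|]; rewrite ?Hi ?Ha //.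
  exact: (group1 <<[set i; a; b]>>%G).
by case/or4P=> [/eqP->|/eqP->|/eqP->|/orP[]/eqP->]; rewrite ?D.
Qed.

(** Some coordinate of i is nonzero, and that coordinate separates g from i + g. This selects one
    point of each pair {g, i + g} in [spoke_scaling]. *)
Lemma coset_split (i : G) : i != 0 ->
  exists c : pred G, forall g, c (i + g) = ~~ c g.
Proof.
move=> i0.
pose cs : seq (pred G) :=
  [:: fun g => g.1.1 == 0; fun g => g.1.2 == 0; fun g => g.2 == 0].
pose c0 : pred G := fun=> true.
have /hasP[n _ H] : has (fun n => all (fun g => nth c0 cs n (i + g) == ~~ nth c0 cs n g)
    enumG) (iota 0 3).
  move: i0; apply/implyP; move: i.
  by apply: (@forallG (fun i => _ ==> _)); vm_compute.
exists (nth c0 cs n) => g; apply/eqP.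
exact: (@forallG (fun g => nth c0 cs n (i + g) == ~~ nth c0 cs n g) H g).
Qed.

(** * Additive permutations of Z_2^3 *)

Definition additive_perm (s : {perm G}) : Prop := {morph s : g h / g + h}.

Lemma additive_perm0 s : additive_perm s -> s 0 = 0.
Proof. by move=> H; rewrite -{1}(addgg 0) H addgg. Qed.

Lemma additive_permV s : additive_perm s -> additive_perm s^-1%g.
Proof. by move=> H g h; apply: (@perm_inj _ s); rewrite H !permKV. Qed.

Lemma additive_permM s t :
  additive_perm s -> additive_perm t -> additive_perm (s * t)%g.
Proof. by move=> Hs Ht g h; rewrite !permM Hs Ht. Qed.

Lemma additive_perm_Aut s : additive_perm s -> s \in Aut [set: G].
Proof.
move=> H; rewrite inE; apply/andP; split; first by apply/fintype.subsetP=> g _; rewrite inE.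
by apply/morphicP=> g h _ _; apply: H.
Qed.

(** The linear map sending the standard basis to i, a, b; coordinates in ['Z_2] are read as natural
    multiplicities. *)
Definition lin3 (i a b g : G) : G := i *+ g.1.1 + a *+ g.1.2 + b *+ g.2.

Lemma lin3_add (i a b : G) : {morph lin3 i a b : g h / g + h}.
Proof.
move=> g h; apply/eqP; move: i a b g h.
by apply: (@forallG5 (fun i a b g h => _ == _)); vm_compute.
Qed.

Lemma lin3_inj (i a b : G) : independent3 i a b -> injective (lin3 i a b).
Proof.
move=> H g h /eqP; rewrite -addg_eq0 -lin3_add => E; apply/eqP; rewrite -addg_eq0.
move: E; move: (g + h) => k; apply/implyP; move: H; apply/implyP; move: i a b k.
by apply: (@forallG4 (fun i a b k => _ ==> _)); vm_compute.
Qed.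

Lemma frame_ex (i a b : G) : independent3 i a b ->
  exists2 s, additive_perm s &
    [/\ s (1, 0, 0) = i, s (0, 1, 0) = a & s (0, 0, 1) = b].
Proof.
move=> H; exists (perm (lin3_inj H)); first by move=> g h; rewrite !permE lin3_add.
by rewrite !permE /lin3 /= !mulr0n !addr0 !add0r.
Qed.

Lemma additive_perm_ex (i a b i' a' b' : G) :
  independent3 i a b -> independent3 i' a' b' ->
  exists2 s, additive_perm s & [/\ s i = i', s a = a' & s b = b'].
Proof.
move=> /frame_ex[s Hs [<- <- <-]] /frame_ex[t Ht [<- <- <-]].
exists (s^-1 * t)%g; first by apply: additive_permM => //; apply: additive_permV.
by rewrite !permM !permK.
Qed.

(** * Supports and concurrent lines *)

(* Unlike ==>, this form does not evaluate c when b is false. *)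
Lemma lazy_imply (b c : bool) : (if b then c else true) -> b -> c.
Proof. by case: b. Qed.

(** The line {g, h, g + h} carries a pair of S. Each pair is tested in one order only, S being
    symmetric below. *)
Definition meets (S : rel G) (g h : G) : bool := [|| S g h, S g (g + h) | S h (g + h)].

(** Two distinct lines of a projective plane share a point i; x and y are second points on the first
    and on the second line. *)
Lemma lines_meet (a b c d : G) :
  a != 0 -> b \notin [:: 0; a] -> c != 0 -> d \notin [:: 0; c] ->
  ~~ ((c \in [:: a; b; a + b]) && (d \in [:: a; b; a + b])) ->
  exists i x y, [/\ independent3 i x y,
    i \in [:: a; b; a + b], x \in [:: a; b; a + b],
    i \in [:: c; d; c + d] & y \in [:: c; d; c + d]].
Proof.
pose ok i x y := [&& independent3 i x y,
    i \in [:: a; b; a + b], x \in [:: a; b; a + b],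
    i \in [:: c; d; c + d] & y \in [:: c; d; c + d]].
move=> a0 ab c0 cd ncd.
suff /hasP[i _ /hasP[x _ /hasP[y _ /and5P H]]] :
    has (fun i => has (fun x => has (ok i x) [:: c; d; c + d]) [:: a; b; a + b])
      [:: a; b; a + b] by exists i, x, y.
rewrite {}/ok; move: ncd; apply/implyP; move: cd; apply/implyP; move: c0; apply/implyP.
move: ab; apply/implyP; move: a0; apply/implyP; move: a b c d.
by apply: (@forallG4 (fun a b c d => _ ==> _)); vm_compute.
Qed.

Section Dichotomy.
Variables (S : rel G) (p : {perm G}).
Hypothesis S_n0 : forall g h, S g h -> g != 0 /\ h \notin [:: 0; g].
Hypothesis S_sym : symmetric S.
Hypothesis p0 : p 0 = 0.
Hypothesis pD : forall g h, S g h -> p (g + h) = p g + p h.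

Lemma meetsD g h : meets S g h -> p (g + h) = p g + p h.
Proof.
case/or3P=> /pD //.
  by rewrite addgK => ->; rewrite addgK.
by rewrite addrCA addgg addr0 => ->; rewrite addrAC addgg add0r.
Qed.

Lemma meets_line g h i a : S g h -> i \in [:: g; h; g + h] ->
  a \in [:: g; h; g + h] -> i != a -> meets S i a.
Proof.
rewrite !inE /meets => Sgh.
have Shg : S h g by rewrite S_sym.
have E : h + g = g + h by rewrite addrC.
have E1 : g + h + g = h by rewrite addrC addgK.
have E2 : g + h + h = g by rewrite addrC addrCA addgg addr0.
have E3 : h + (g + h) = g by rewrite addrCA addgg addr0.
by case/or3P=> /eqP->; case/or3P=> /eqP->; rewrite ?eqxx // => _;
  rewrite ?addgK ?E ?E1 ?E2 ?E3 ?Sgh ?Shg ?orbT.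
Qed.

Lemma perm_eq0 g : (p g == 0) = (g == 0).
Proof. by rewrite -p0 (inj_eq perm_inj) p0. Qed.

Lemma independent3_perm i a b : independent3 i a b -> meets S i a ->
  independent3 (p i) (p a) (p b).
Proof.
move=> /and3P[i0 a0 b0] /meetsD E.
rewrite /independent3 -E !inE !perm_eq0 !(inj_eq perm_inj) i0 /=.
by move: a0 b0; rewrite !inE => -> ->.
Qed.

Definition agrees (s : {perm G}) : Prop := forall g h, S g h -> s g = p g /\ s h = p h.

(** Injectivity forces the last value: p x = s y with y != x would give p y = s y = p x. *)
Lemma perm_off_one (s : {perm G}) x :
  (forall g, g != x -> s g = p g) -> forall g, s g = p g.
Proof.
move=> H g; have [->|/H //] := eqVneq g x.
have [y Hy] : exists y, p x = s y by exists (s^-1%g (p x)); rewrite permKV.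
have [Ey|ny] := eqVneq y x; first by rewrite Hy Ey.
by have := H y ny; rewrite -Hy => /perm_inj E; rewrite E eqxx in ny.
Qed.

Theorem agrees_or_concurrent : (exists2 s, additive_perm s & agrees s) \/
  exists i a b, [/\ independent3 i a b, meets S i a, meets S i b, meets S i (a + b) &
    forall g h, S g h -> i \in [:: g; h; g + h]].
Proof.
have [[a0 [b0 S0]]|noS] := pselect (exists a b, S a b); last first.
  left; exists 1%g; first by move=> g h; rewrite !perm1.
  by move=> g h Sgh; case: noS; exists g, h.
have [a00 b00] := S_n0 S0.
(* If all pairs lie on one line, p restricted to that line extends to an additive permutation after
   completing to a basis. *)
have [one|] := pselect (forall g h, S g h ->
    (g \in [:: a0; b0; a0 + b0]) && (h \in [:: a0; b0; a0 + b0])).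
  left; have [c Hc] := independent3_ex a00 b00.
  have Hm : meets S a0 b0 by rewrite /meets S0.
  have [s Hs [Ea Eb _]] := additive_perm_ex Hc (independent3_perm Hc Hm).
  exists s => // g h /one; rewrite !inE.
  have E : s (a0 + b0) = p (a0 + b0) by rewrite Hs (meetsD Hm) Ea Eb.
  by case/andP=> /or3P[]/eqP-> /or3P[]/eqP->; rewrite ?Ea ?Eb ?E.
move=> /existsNP[c0 /existsNP[d0 /not_implyP[S1 /negP ncd]]].
have [c00 d00] := S_n0 S1.
have [i [a [b [Hi ia aa ib bb]]]] := lines_meet a00 b00 c00 d00 ncd.
have mia : meets S i a.
  by apply: (meets_line S0) => //; apply: contraTneq Hi => ->;
    rewrite /independent3 !inE eqxx !orbT /= andbF.
have mib : meets S i b.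
  by apply: (meets_line S1) => //; apply: contraTneq Hi => ->;
    rewrite /independent3 !inE eqxx !orbT /= !andbF.
have [s Hs [Ei Ea Eb]] := additive_perm_ex Hi (independent3_perm Hi mia).
have Eia : s (i + a) = p (i + a) by rewrite Hs (meetsD mia) Ei Ea.
have Eib : s (i + b) = p (i + b) by rewrite Hs (meetsD mib) Ei Eb.
have E0 : s 0 = p 0 by rewrite p0 additive_perm0.
have [Hag|/existsNP[g /existsNP[h /not_implyP[Sgh nag]]]] := pselect (agrees s).
  by left; exists s.
right; exists i, a, b.
have conc g1 h1 : S g1 h1 -> i \in [:: g1; h1; g1 + h1].
  move=> S2; apply/negPn/negP => ni; apply: nag.
  (* A line missing i has one point on each of the three lines through i. On two of these s = p is
     known, so the third point, on the last line, becomes known too; then s and p can differ in one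
     point at most. *)
  suff H : s (a + b) = p (a + b) \/ s (i + (a + b)) = p (i + (a + b)).
    have {}H : forall g, s g = p g.
      by case: H => H; [apply: (@perm_off_one s (i + (a + b)))|
        apply: (@perm_off_one s (a + b))] => g' ng'; have := span3 g' Hi;
        rewrite !inE => /or4P[/eqP->|/eqP->|/eqP->|] //;
        case/or4P => [/eqP->|/eqP->|/eqP->|/orP[]/eqP Eg] //;
        move: ng'; rewrite Eg ?eqxx //.
    by rewrite !H.
  pose known : seq G := [:: i; a; b; i + a; i + b].
  have Hk x : x \in known -> s x = p x.
    by rewrite !inE => /or4P[/eqP->|/eqP->|/eqP->|/orP[]/eqP->].
  have Hx x y : x \in known -> y \in known -> meets S x y -> s (x + y) = p (x + y).
    by move=> kx ky m; rewrite Hs (meetsD m) !Hk.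
  pose L := [:: g1; h1; g1 + h1].
  suff /hasP[x /[dup] kx Lx /hasP[y ky Hxy]]: has (fun x => has (fun y =>
      [&& x \in L, y \in L, x != y & (x + y) \in [:: a + b; i + (a + b)]]) known) known.
    case/and4P: Hxy => Lx' Ly' xy; have := Hx _ _ Lx ky (meets_line S2 Lx' Ly' xy).
    by move=> H; rewrite !inE => /orP[]/eqP E; rewrite -E; auto.
  have [g10 h10] := S_n0 S2.
  rewrite /known {}/L; move: ni; apply: lazy_imply; move: h10; apply: lazy_imply.
  move: g10; apply: lazy_imply; move: Hi; apply: lazy_imply.
  move: {+}i {+}a {+}b {+}g1 {+}h1.
  by apply: (@forallG5 (fun i a b g1 h1 => if _ then _ else true)); vm_compute.
split=> //.
(* A point of the support where s and p differ must lie on the third line through i, so that line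
   carries a pair of S as well. *)
have {g h Sgh nag} [g [h [Sgh nag]]] : exists g h, S g h /\ s g <> p g.
  have [E|] := pselect (s g = p g); last by exists g, h.
  by exists h, g; rewrite S_sym; split=> // E'; apply: nag.
have gg : g \in [:: a + b; i + (a + b)].
  have := span3 g Hi; rewrite !inE.
  by case/or4P=> [/eqP E|/eqP E|/eqP E|]; try (by case: nag; rewrite E);
   case/or4P=> [/eqP E|/eqP E|/eqP E| //]; case: nag; rewrite E.
have ing : g \in [:: g; h; g + h] by rewrite !inE eqxx.
have gi : i != g by apply: contra_notN nag => /eqP <-; rewrite Ei.
have m := meets_line Sgh (conc _ _ Sgh) ing gi.
move: gg m; rewrite !inE => /orP[]/eqP-> //.
by rewrite /meets addgK => /or3P[] H; rewrite ?H ?orbT // (S_sym (a + b)) H !orbT.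
Qed.

(** What the Jacobi identity imposes on supports; [supp_nice] proves it for graded contractions. *)
Hypothesis nice : forall i j k, independent3 i j k -> S k (i + k) -> S i j -> S j k.

(* rim_support i says that S is X^(i); spoke_support i says that S is contained in X_(i) and
   meets each of the three lines through i. *)
Definition spoke_support (i : G) : Prop :=
  (forall g h, S g h -> g = i \/ h = i) /\
  (forall g, g \notin [:: 0; i] -> S i g || S i (i + g)).

Definition rim_support (i : G) : Prop :=
  forall g h, S g h = [&& g \notin [:: 0; i] & h == i + g].

(** By [nice], a rim pair {k, i + k} and a spoke {i, j} on another line would put {j, k}, whose line
    misses i, in S. So one rim pair forces rim pairs on the other two lines, and these in turn
    exclude every spoke. *)
Lemma concurrent_cases i a b :
  independent3 i a b -> meets S i a -> meets S i b -> meets S i (a + b) ->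
  (forall g h, S g h -> i \in [:: g; h; g + h]) ->
  rim_support i \/ spoke_support i.
Proof.
move=> Hi ma mb mab conc; have i0 : i != 0 by case/and3P: Hi.
have mE g : meets S i g -> meets S i (i + g).
  by rewrite /meets addgK => /or3P[] H; rewrite ?H ?orbT // (S_sym (i + g)) H !orbT.
have m g : g \notin [:: 0; i] -> meets S i g.
  have := span3 g Hi; rewrite !inE.
  case/or4P=> [/eqP->|/eqP->|/eqP-> //|]; rewrite ?eqxx ?orbT //.
  by case/or4P=> [/eqP->|/eqP->|/eqP-> //|/orP[]/eqP->] // _; apply: mE.
have excl j k : independent3 i j k -> S k (i + k) -> ~~ S i j.
  move=> Hijk Sk; apply/negP=> /(nice Hijk Sk) /conc.
  apply/negP; move: Hijk; apply/implyP; move: {+}i {+}j {+}k.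
  by apply: (@forallG3 (fun i j k => _ ==> _)); vm_compute.
have step j k : independent3 i j k -> S k (i + k) -> S j (i + j).
  move=> H Sk; have jn : j \notin [:: 0; i] by case/and3P: H.
  case/or3P: (m j jn) => // H'; first by have := excl _ _ H Sk; rewrite H'.
  suff /excl : independent3 i (i + j) k by move/(_ Sk); rewrite H'.
  move: H {Sk H' jn}; apply/implyP; move: {+}i {+}j {+}k.
  by apply: (@forallG3 (fun i j k => _ ==> _)); vm_compute.
have [[k [kn Sk]]|none] := pselect (exists k, k \notin [:: 0; i] /\ S k (i + k)).
  have [j Hj] := independent3_ex i0 kn.
  have Sj := step _ _ (independent3_swap Hj) Sk.
  have all g : g \notin [:: 0; i] -> S g (i + g).
    move=> gn; have : independent3 i g k || independent3 i g j.
      move: gn; apply/implyP; move: Hj {Sk Sj kn}; apply/implyP.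
      move: {+}i {+}k {+}j {+}g.
      by apply: (@forallG4 (fun i k j g => _ ==> _)); vm_compute.
    by case/orP=> /step; apply.
  left=> g h; apply/idP/andP=> [Sgh|[gn /eqP->]]; last exact: all.
  have [g0 h0] := S_n0 Sgh.
  have no j' : j' \notin [:: 0; i] -> ~~ S i j'.
    by move=> jn; have [k' Hk'] := independent3_ex i0 jn; apply: (excl _ k') => //;
       apply: all; case/and3P: (independent3_swap Hk').
  have gi : g != i.
    by apply: contraTneq Sgh => Eg; rewrite Eg; apply: no; rewrite -Eg.
  have hi : h != i.
    apply: contraTneq Sgh => Eh; rewrite S_sym Eh; apply: no.
    by rewrite !inE (negbTE g0).
  have E : i = g + h.
    have := conc _ _ Sgh; rewrite !inE.
    by rewrite eq_sym (negbTE gi) eq_sym (negbTE hi) => /eqP.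
  rewrite !inE (negbTE g0) (negbTE gi); split=> //.
  by rewrite E addrAC addgg add0r.
right; split=> [g h Sgh|g gn].
  move: (conc _ _ Sgh); rewrite !inE => /or3P[/eqP|/eqP|/eqP E]; [by left|by right|].
  have [g0 h0] := S_n0 Sgh; have [Eg|gi] := eqVneq g i; first by left.
  case: none; exists g; rewrite !inE (negbTE g0) gi; split=> //.
  by rewrite E addrAC addgg add0r.
case/or3P: (m g gn) => H; rewrite ?H ?orbT //.
by case: none; exists g.
Qed.

End Dichotomy.

(** * Gradings and glued maps *)

Section LinearFunctions.
Variables (C : fieldType) (V : lmodType C) (f : V -> V).
Hypothesis f_lin : linear f.

Lemma linear_funD x y : f (x + y) = f x + f y.
Proof. by have := f_lin 1 x y; rewrite !scale1r. Qed.

Lemma linear_fun0 : f 0 = 0.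
Proof. by apply: (addrI (f 0)); rewrite -linear_funD !addr0. Qed.

Lemma linear_funZ a x : f (a *: x) = a *: f x.
Proof. by have := f_lin a x 0; rewrite !addr0 linear_fun0 addr0. Qed.

Lemma linear_fun_sum (T : finType) (F : T -> V) : f (\sum_t F t) = \sum_t f (F t).
Proof. by apply: (big_morph f linear_funD linear_fun0). Qed.

End LinearFunctions.

Section Brackets.
Variables (C : fieldType) (L : lmodType C) (br : L -> L -> L).
Hypothesis br_lie : is_lie_bracket br.

Lemma br0l y : br 0 y = 0.
Proof. by have := lie_linl br_lie (-1) 0 0 y; rewrite scaler0 addr0 scaleN1r addNr. Qed.

Lemma br0r y : br y 0 = 0.
Proof. by have := lie_linr br_lie (-1) y 0 0; rewrite scaler0 addr0 scaleN1r addNr. Qed.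

Lemma brZl a x y : br (a *: x) y = a *: br x y.
Proof. by have := lie_linl br_lie a x 0 y; rewrite br0l !addr0. Qed.

Lemma brZr a x y : br x (a *: y) = a *: br x y.
Proof. by have := lie_linr br_lie a x y 0; rewrite br0r !addr0. Qed.

Lemma brDl x y z : br (x + y) z = br x z + br y z.
Proof. by have := lie_linl br_lie 1 x y z; rewrite !scale1r. Qed.

Lemma brDr x y z : br x (y + z) = br x y + br x z.
Proof. by have := lie_linr br_lie 1 x y z; rewrite !scale1r. Qed.

Lemma brC x y : br x y = - br y x.
Proof.
apply/eqP; rewrite -addr_eq0; apply/eqP.
by have := lie_alt br_lie (x + y); rewrite brDl !brDr !(lie_alt br_lie) add0r addr0.
Qed.

End Brackets.

Section Grading.
Variables (C : fieldType) (Gam : gradedLieAlgebra C).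
Hypothesis Gam_grading : is_grading Gam.
Implicit Types (x y z : Gam) (g h : G) (eps : G -> G -> C).

Lemma componentsP x : decomposes x (components x).
Proof.
have [u [Hu _]] := grading_direct Gam_grading x.
by apply: (@xgetPex _ _ (decomposes x)); exists u.
Qed.

Lemma components_uniq x u : decomposes x u -> components x = u.
Proof.
have [v [_ Hv]] := grading_direct Gam_grading x => Hu.
by rewrite -(Hv _ (componentsP x)) (Hv _ Hu).
Qed.

Lemma components_in x g : gla_comp g (components x g).
Proof. by case: (componentsP x). Qed.

Lemma sum_components x : \sum_g components x g = x.
Proof. by case: (componentsP x). Qed.

Lemma component0 g : @gla_comp C Gam g 0.
Proof. by case: (grading_sub Gam_grading g). Qed.

Lemma componentZ g a x : gla_comp g x -> gla_comp g (a *: x).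
Proof.
by move=> Hx; rewrite -[_ *: _]addr0; case: (grading_sub Gam_grading g) => H0 H;
  apply: H.
Qed.

Lemma components_linear a x y g :
  components (a *: x + y) g = a *: components x g + components y g.
Proof.
pose u := [ffun g => a *: components x g + components y g].
rewrite (@components_uniq _ u) ?ffunE //; split.
  by move=> h; rewrite ffunE; case: (grading_sub Gam_grading h) => _; apply;
    apply: components_in.
rewrite -{1}(sum_components x) -{1}(sum_components y) scaler_sumr -big_split.
by apply: eq_bigr => h _; rewrite ffunE.
Qed.

Lemma components_hom g x h : gla_comp g x ->
  components x h = if h == g then x else 0.
Proof.
move=> Hx; pose u := [ffun h => if h == g then x else 0].
rewrite (@components_uniq _ u) ?ffunE //; split.
  by move=> k; rewrite ffunE; case: eqP => [->|_] //; apply: component0.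
rewrite (bigD1 g) //= ffunE eqxx big1 ?addr0 // => k kg.
by rewrite ffunE (negbTE kg).
Qed.

Lemma component_disjoint g h x : gla_comp g x -> gla_comp h x -> x != 0 -> g = h.
Proof.
move=> Hg Hh; have := components_hom g Hg; rewrite (components_hom g Hh) eqxx.
by case: (g =P h) => // _ ->; rewrite eqxx.
Qed.

Lemma contracted_hom eps g h x y : gla_comp g x -> gla_comp h y ->
  contracted_br eps x y = eps g h *: lie_br x y.
Proof.
move=> Hx Hy; have lieP := lie_axioms Gam.
rewrite /contracted_br (bigD1 g) //= [X in _ + X]big1 ?addr0; last first.
  move=> k kg; rewrite big1 // => l _.
  by rewrite (components_hom k Hx) (negbTE kg) (br0l lieP) scaler0.
rewrite (bigD1 h) //= [X in _ + X]big1 ?addr0; last first.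
  by move=> k kh; rewrite (components_hom k Hy) (negbTE kh) (br0r lieP) scaler0.
by rewrite (components_hom g Hx) (components_hom h Hy) !eqxx.
Qed.

Section Glue.
Variables (F : G -> Gam -> Gam) (s : {perm G}).
Hypothesis F_lin : forall g, linear (F g).
Hypothesis F_inj : forall g, injective (F g).
Hypothesis F_comp : forall g, (F g @` gla_comp g)%classic = gla_comp (s g).

(** Each [F g] is a map of the whole algebra, but only its restriction to degree g enters. *)
Definition glue x : Gam := \sum_g F g (components x g).

Lemma F_in g x : gla_comp g x -> gla_comp (s g) (F g x).
Proof. by move=> Hx; rewrite -F_comp; exists x. Qed.

Lemma components_glue x g : components (glue x) (s g) = F g (components x g).
Proof.
pose u := [ffun h => F (s^-1 h)%g (components x (s^-1 h)%g)].
rewrite (@components_uniq _ u) ?ffunE ?permK //; split.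
  by move=> h; rewrite ffunE -{1}(permKV s h); apply: F_in; apply: components_in.
rewrite /glue [RHS](reindex_inj (@perm_inj _ s)) /=.
by apply: eq_bigr => h _; rewrite ffunE permK.
Qed.

Lemma glue_hom g x : gla_comp g x -> glue x = F g x.
Proof.
move=> Hx; rewrite /glue (bigD1 g) //= (components_hom g Hx) eqxx big1 ?addr0 //.
by move=> k kg; rewrite (components_hom k Hx) (negbTE kg) linear_fun0.
Qed.

Lemma glue_linear : linear glue.
Proof.
move=> a x y; rewrite /glue scaler_sumr -big_split /=; apply: eq_bigr => g _.
by rewrite components_linear F_lin.
Qed.

Lemma glue_bij : bijective glue.
Proof.
have inj : injective glue.
  move=> x y E; rewrite -(sum_components x) -(sum_components y).
  by apply: eq_bigr => g _; apply: (@F_inj g); rewrite -!components_glue E.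
have sur y : exists x, glue x = y.
  have /choice[u Hu] : forall g, exists x, gla_comp g x /\ F g x = components y (s g).
    move=> g; have := components_in y (s g); rewrite -F_comp => -[x Hx E].
    by exists x.
  exists (\sum_g u g); rewrite -[RHS]sum_components.
  rewrite [RHS](reindex_inj (@perm_inj _ s)) /= (linear_fun_sum glue_linear).
  by apply: eq_bigr => g _; have [Hg <-] := Hu g; rewrite (glue_hom Hg).
have /choice[k Hk] := sur.
by exists k => // x; apply: inj; rewrite Hk.
Qed.

Lemma glue_comp g : (glue @` gla_comp g)%classic = gla_comp (s g).
Proof.
rewrite -F_comp; apply/seteqP; split=> y [x Hx <-]; exists x => //.
  by rewrite (glue_hom Hx).
by rewrite (glue_hom Hx).
Qed.

(** Contracted brackets are sums over pairs of degrees, so compatibility can be tested one pair of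
    degrees at a time, with unrelated maps in different degrees. *)
Lemma glue_iso eps eps' :
  (forall g h x y, gla_comp g x -> gla_comp h y ->
    eps g h *: F (g + h) (lie_br x y) =
    eps' (s g) (s h) *: lie_br (F g x) (F h y)) ->
  is_lie_iso (contracted_br eps) (contracted_br eps') glue.
Proof.
move=> H; split; [exact: glue_linear|exact: glue_bij|].
move=> x y; rewrite /contracted_br (linear_fun_sum glue_linear).
rewrite [RHS](reindex_inj (@perm_inj _ s)); apply: eq_bigr => g _ /=.
rewrite (linear_fun_sum glue_linear).
rewrite [RHS](reindex_inj (@perm_inj _ s)); apply: eq_bigr => h _ /=.
have Hx := components_in x g; have Hy := components_in y h.
rewrite (linear_funZ glue_linear) (glue_hom (grading_br Gam_grading Hx Hy)).
by rewrite !components_glue -H.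
Qed.

End Glue.

End Grading.

(** * Good gradings and their contractions *)

Section Good.
Variables (C : fieldType) (Gam : gradedLieAlgebra C).
Hypothesis Gam_good : good Gam.
Implicit Types (x y z : Gam) (g h k : G) (eps : G -> G -> C).

Let gr : is_grading Gam := good_grading Gam_good.
Let lieP := lie_axioms Gam.

(** Condition (iii) for degrees k, g, h, where k completes a basis: if [x, y] were zero, so would be
    [z, [x, y]], one of two independent vectors. *)
Lemma bracket_neq0 g h : g != 0 -> h \notin [:: 0; g] ->
  exists x y, [/\ gla_comp g x, gla_comp h y & lie_br x y != 0 :> Gam].
Proof.
move=> g0 h0; have [k Hk] := independent3_ex g0 h0.
have /independent3_rot/independent3_rot/generated_independent3 := Hk.
move/(good_gen Gam_good) => [z [x [y [Hz Hx Hy li]]]].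
exists x, y; split=> //; apply/eqP=> E; have := li 1 0.
by rewrite E (br0r lieP) scaler0 scale0r addr0 => /(_ erefl) [/eqP]; rewrite oner_eq0.
Qed.

Lemma component_neq0 g : g != 0 -> exists2 x, @gla_comp C Gam g x & x != 0.
Proof.
move=> g0; have [h h0] : exists h, h \notin [:: 0; g].
  suff /hasP[h _ Hh] : has (fun h => h \notin [:: 0; g]) enumG by exists h.
  by move: {+}g; apply: forallG; vm_compute.
have [x [y [Hx _ nz]]] := bracket_neq0 g0 h0; exists x => //.
by apply: contraNneq nz => ->; rewrite (br0l lieP).
Qed.

Lemma component_inj g h : @gla_comp C Gam g = gla_comp h -> g = h.
Proof.
have H g1 h1 : g1 != 0 -> @gla_comp C Gam g1 = gla_comp h1 -> g1 = h1.
  move=> /component_neq0[x Hx nx] E.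
  by apply: (component_disjoint gr Hx _ nx); rewrite -E.
have [->|g0] := eqVneq g 0; last exact: H.
have [->|h0] // := eqVneq h 0; by move/esym/(H _ _ h0).
Qed.

(** Components determine their degrees, so f induces an injective map of degrees; it fixes 0 because
    only the neutral component is zero. *)
Lemma component_perm (f : Gam -> Gam) : linear f -> bijective f ->
  permutes_components f ->
  exists2 p : {perm G}, p 0 = 0 & forall g, (f @` gla_comp g)%classic = gla_comp (p g).
Proof.
move=> flin fbij /choice[p Hp].
have pinj : injective p.
  move=> g h E; apply: component_inj; apply/seteqP.
  by split=> x Hx; [have : gla_comp (p h) (f x) by rewrite -E -Hp; exists x
    |have : gla_comp (p g) (f x) by rewrite E -Hp; exists x];
    rewrite -Hp => -[y Hy /(bij_inj fbij) <-].
exists (perm pinj); last by move=> g; rewrite permE.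
rewrite permE; apply: component_inj; rewrite -Hp (good_e Gam_good).
by rewrite image_set1 (linear_fun0 flin).
Qed.

Section Support.
Variable eps : G -> G -> C.
Hypotheses (eps_gc : graded_contraction Gam eps) (eps_adm : admissible eps).

Definition supp : rel G := fun g h => eps g h != 0.

Lemma supp_neq0 g h : supp g h -> g != 0 /\ h \notin [:: 0; g].
Proof.
have [H1 H2 H3] := eps_adm g; have [_ H4 H5] := eps_adm h.
rewrite /supp !inE => nz; split; first by apply: contraNneq nz => ->; rewrite H4.
by apply/norP; split; apply: contraNneq nz => ->; rewrite ?H3 ?H1.
Qed.

(** Both brackets are antisymmetric and some [x, y] in these degrees is nonzero, so its two
    coefficients coincide. *)
Lemma eps_sym g h : eps g h = eps h g.
Proof.
have [-> //|gh] := eqVneq g h.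
have [->|g0] := eqVneq g 0; first by have [_ -> ->] := eps_adm h.
have [->|h0] := eqVneq h 0; first by have [_ -> ->] := eps_adm g.
have h1 : h \notin [:: 0; g] by rewrite !inE (negbTE h0) eq_sym.
have [x [y [Hx Hy nz]]] := bracket_neq0 g0 h1.
have := brC eps_gc x y; rewrite !(contracted_hom gr _ Hx Hy) (contracted_hom gr _ Hy Hx).
rewrite (brC lieP y x) scalerN opprK => /eqP.
by rewrite -subr_eq0 -scalerBl scaler_eq0 (negbTE nz) orbF subr_eq0 => /eqP.
Qed.

Lemma supp_sym : symmetric supp.
Proof. by move=> g h; rewrite /supp eps_sym. Qed.

(* The contracted Jacobi identity for generating degrees j, k, i + k, compared with the
   original one, forces the coefficients of [x, [y, z]] and [z, [x, y]] to agree. *)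
Lemma supp_nice i j k : independent3 i j k -> supp k (i + k) -> supp i j -> supp j k.
Proof.
move=> H S1 S2; have H' : independent3 j k (i + k).
  move: H {S1 S2}; apply/implyP; move: {+}i {+}j {+}k.
  by apply: (@forallG3 (fun i j k => _ ==> _)); vm_compute.
have [x [y [z [Hx Hy Hz li]]]] := good_gen Gam_good (generated_independent3 H').
have Hyz := grading_br gr Hy Hz; have Hzx := grading_br gr Hz Hx.
have Hxy := grading_br gr Hx Hy.
have := lie_jac eps_gc x y z.
rewrite (contracted_hom gr _ Hy Hz) (contracted_hom gr _ Hz Hx) (contracted_hom gr _ Hx Hy).
rewrite !(brZr eps_gc) (contracted_hom gr _ Hx Hyz) (contracted_hom gr _ Hy Hzx).
rewrite (contracted_hom gr _ Hz Hxy) !scalerA.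
have -> : lie_br z (lie_br x y) = - lie_br x (lie_br y z) - lie_br y (lie_br z x).
  have := lie_jac lieP x y z; set u := lie_br x _; set v := lie_br y _.
  by move=> E; apply: (addrI (u + v)); rewrite E -opprD addrN.
set u := lie_br x _; set v := lie_br y _; set a := _ * _; set b := _ * _.
set c := _ * _; rewrite scalerBr scalerN addrACA -!scalerBl => /li[/eqP].
rewrite subr_eq0 => /eqP E _.
have : a != 0.
  rewrite /a mulf_neq0 //.
  have -> : k + (i + k) = i by rewrite addrCA addgg addr0.
  by rewrite eps_sym.
by rewrite E; apply: contraNneq; rewrite /c => ->; rewrite mul0r.
Qed.

End Support.

(** * Degrees and supports under an isomorphism of contractions *)

Section Isomorphism.
Variables eps eps' : G -> G -> C.
Hypotheses (eps_gc : graded_contraction Gam eps) (eps_adm : admissible eps).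
Hypotheses (eps_gc' : graded_contraction Gam eps') (eps_adm' : admissible eps').
Variables (f : Gam -> Gam) (p : {perm G}).
Hypothesis f_iso : is_lie_iso (contracted_br eps) (contracted_br eps') f.
Hypothesis f_comp : forall g, (f @` gla_comp g)%classic = gla_comp (p g).

Lemma iso_in g x : gla_comp g x -> gla_comp (p g) (f x).
Proof. by move=> Hx; rewrite -f_comp; exists x. Qed.

Lemma iso_hom g h x y : gla_comp g x -> gla_comp h y ->
  eps g h *: f (lie_br x y) = eps' (p g) (p h) *: lie_br (f x) (f y).
Proof.
move=> Hx Hy; have := lie_iso_br f_iso x y.
rewrite (contracted_hom gr _ Hx Hy) (contracted_hom gr _ (iso_in Hx) (iso_in Hy)).
by rewrite (linear_funZ (lie_iso_linear f_iso)).
Qed.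

Lemma iso_neq0 x : (f x == 0) = (x == 0).
Proof.
rewrite -{1}(linear_fun0 (lie_iso_linear f_iso)).
exact: (inj_eq (bij_inj (lie_iso_bij f_iso))).
Qed.

Lemma iso_supp g h : supp eps' (p g) (p h) = supp eps g h.
Proof.
apply/idP/idP => S.
  have [g0 h0] := supp_neq0 eps_adm' S.
  have [x' [y' [Hx' Hy' nz]]] := bracket_neq0 g0 h0.
  move: Hx' Hy' nz; rewrite -!f_comp => -[x Hx <-] [y Hy <-] nz.
  move: (iso_hom Hx Hy); rewrite /supp; case: eqP => // -> /eqP.
  by rewrite scale0r eq_sym scaler_eq0 (negbTE nz) orbF => E; rewrite /supp E in S.
have [g0 h0] := supp_neq0 eps_adm S.
have [x [y [Hx Hy nz]]] := bracket_neq0 g0 h0.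
move: (iso_hom Hx Hy); rewrite /supp; case: eqP => // -> /eqP.
by rewrite scale0r scaler_eq0 iso_neq0 (negbTE nz) orbF => E; rewrite /supp E in S.
Qed.

(** The image of a nonzero bracket is homogeneous of degree p (g + h), and also of degree p g + p
    h. *)
Lemma iso_permD g h : supp eps g h -> p (g + h) = p g + p h.
Proof.
move=> S; have [g0 h0] := supp_neq0 eps_adm S.
have [x [y [Hx Hy nz]]] := bracket_neq0 g0 h0.
have H1 := iso_in (grading_br gr Hx Hy).
have H2 := grading_br gr (iso_in Hx) (iso_in Hy).
apply: (@component_disjoint _ _ gr _ _ (eps g h *: f (lie_br x y))).
- exact: componentZ.
- by rewrite (iso_hom Hx Hy); apply: componentZ.
- by rewrite scaler_eq0 (negbTE S) iso_neq0.
Qed.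

End Isomorphism.

Lemma aut_perm_additive (f : Gam -> Gam) (p : {perm G}) : is_aut f -> p 0 = 0 ->
  (forall g, (f @` gla_comp g)%classic = gla_comp (p g)) -> additive_perm p.
Proof.
move=> [flin fbij fbr] p0 Hp g h.
have [->|g0] := eqVneq g 0; first by rewrite p0 !add0r.
have [->|h0] := eqVneq h 0; first by rewrite p0 !addr0.
have [->|gh] := eqVneq g h; first by rewrite !addgg.
have h1 : h \notin [:: 0; g] by rewrite !inE (negbTE h0) eq_sym.
have [x [y [Hx Hy nz]]] := bracket_neq0 g0 h1.
have fin k u : gla_comp k u -> gla_comp (p k) (f u) by move=> Hu; rewrite -Hp; exists u.
apply: (@component_disjoint _ _ gr _ _ (f (lie_br x y))).
- exact: fin (grading_br gr Hx Hy).
- by rewrite fbr; apply: (grading_br gr (fin _ _ Hx) (fin _ _ Hy)).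
- by rewrite -(linear_fun0 flin) (inj_eq (bij_inj fbij)).
Qed.

Lemma in_Aut_comp (f f' : Gam -> Gam) : in_Aut f -> in_Aut f' -> in_Aut (f \o f').
Proof.
move=> [[flin fbij fbr] Hf] [[flin' fbij' fbr'] Hf']; split.
  split; first by move=> a x y; rewrite /= flin' flin.
    exact: bij_comp.
  by move=> x y; rewrite /= fbr' fbr.
by move=> g; have [h Hh] := Hf' g; have [k Hk] := Hf h; exists k;
  rewrite -image_comp Hh Hk.
Qed.

(* Only the abstract isomorphism class of the Weyl group is known: the degree
   permutations of preimages of Aut G under phi give an injective self-map of
   the finite set Aut G, hence a surjective one. *)
Lemma additive_perm_lift (s : {perm G}) : weyl_isog_AutG Gam -> additive_perm s ->
  exists2 f : Gam -> Gam, is_aut f &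
    forall g, (f @` gla_comp g)%classic = gla_comp (s g).
Proof.
move=> [phi [_ phiM phi_sur phi_ker]] Hs.
have lift (a : {perm G}) : exists fp : (Gam -> Gam) * {perm G}, a \in Aut [set: G] ->
    [/\ in_Aut fp.1, phi fp.1 = a, fp.2 0 = 0 &
        forall g, (fp.1 @` gla_comp g)%classic = gla_comp (fp.2 g)].
  (* The pair [(id, 1)] is a default outside [Aut G], which makes the choice function total. *)
  have [Ha|na] := boolP (a \in Aut [set: G]); last by exists (id, 1%g).
  have [f Hf Ef] := phi_sur a Ha.
  have [[flin fbij _] Hperm] := Hf.
  by have [p p0 Hp] := component_perm flin fbij Hperm; exists (f, p).
have {lift}/choice[fp Hfp] := lift.
have comp a b : a \in Aut [set: G] -> b \in Aut [set: G] -> forall g,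
    (((fp a).1 \o (fp b).1) @` gla_comp g)%classic = gla_comp ((fp a).2 ((fp b).2 g)).
  move=> Ha Hb g; have [_ _ _ H1] := Hfp _ Ha; have [_ _ _ H2] := Hfp _ Hb.
  by rewrite -image_comp H2 H1.
pose psi a := (fp a).2.
have psi_inj : {in Aut [set: G] &, injective psi}.
  move=> a b Ha Hb E.
  have Ha' : a^-1%g \in Aut [set: G] by rewrite groupV.
  have [A1 A2 _ A4] := Hfp _ Ha; have [B1 B2 _ B4] := Hfp _ Hb.
  have [D1 D2 _ D4] := Hfp _ Ha'.
  (* The chosen lift of the inverse of a, composed with that of a, stabilizes all components. Since
     a and b permute degrees alike, so does its composite with the lift of b, and the kernel
     condition gives a = b. *)
  have : in_Stab ((fp a^-1%g).1 \o (fp a).1).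
    apply/phi_ker; first exact: in_Aut_comp.
    by rewrite phiM // A2 D2 mulgV.
  case=> _ pres.
  have : in_Stab ((fp a^-1%g).1 \o (fp b).1).
    split; first by case: (in_Aut_comp D1 B1).
    move=> g; rewrite comp // -[(fp b).2]/(psi b) -E -[psi a]/((fp a).2) -comp //.
  move/phi_ker => /(_ (in_Aut_comp D1 B1)).
  by rewrite phiM // D2 B2 => /eqP; rewrite -eq_mulgV1 => /eqP ->.
have psi_sub : [set psi a | a in Aut [set: G]] \subset Aut [set: G].
  apply/fintype.subsetP => _ /imsetP[a Ha ->]; have [[A1 _] _ A3 A4] := Hfp _ Ha.
  exact: additive_perm_Aut (aut_perm_additive A1 A3 A4).
have psi_im : [set psi a | a in Aut [set: G]] = Aut [set: G].
  by apply/eqP; rewrite eqEcard psi_sub (card_in_imset psi_inj) leqnn.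
have := additive_perm_Aut Hs; rewrite -psi_im => /imsetP[a Ha ->].
by have [[A1 _] _ _ A4] := Hfp _ Ha; exists (fp a).1.
Qed.

End Good.

(** * Translation to the Fano plane *)

(* ord_enum does not reduce: insub is blocked by the opaque idP. *)
Definition enumI : seq I :=
  [:: @Ordinal 7 0 isT; @Ordinal 7 1 isT; @Ordinal 7 2 isT; @Ordinal 7 3 isT;
      @Ordinal 7 4 isT; @Ordinal 7 5 isT; @Ordinal 7 6 isT].

Lemma forallI (P : pred I) : all P enumI -> forall i, P i.
Proof. by move=> /allP H i; apply: H; case: i; do 7 (case=> [|] //). Qed.

Lemma forallI2 (P : I -> I -> bool) :
  all (fun i => all (P i) enumI) enumI -> forall i j, P i j.
Proof. by move=> H i; apply: forallI; apply: (forallI H). Qed.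

Lemma forallI3 (P : I -> I -> I -> bool) :
  all (fun i => all (fun j => all (P i j) enumI) enumI) enumI ->
  forall i j k, P i j k.
Proof. by move=> H i; apply: forallI2; apply: (forallI H). Qed.

Lemma gI_neq0 (i : I) : gI i != 0.
Proof. by move: i; apply: forallI; vm_compute. Qed.

Lemma gI_inj : injective gI.
Proof.
move=> i j /eqP H; apply/eqP; move: H; apply/implyP; move: i j.
by apply: (@forallI2 (fun i j => _ ==> _)); vm_compute.
Qed.

Lemma gI_surj (g : G) : g != 0 -> exists i, gI i = g.
Proof.
move=> g0; suff /hasP[i _ /eqP Hi] : has (fun i => gI i == g) enumI by exists i.
by move: g0; apply/implyP; move: g; apply: (@forallG (fun g => _ ==> _)); vm_compute.
Qed.

Lemma on_lineE (i j k : I) : on_line i j k = (i != j) && (gI k == gI i + gI j).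
Proof.
apply/eqP; move: i j k.
by apply: (@forallI3 (fun i j k => _ == _)); vm_compute.
Qed.

Lemma gI_star (i j : I) : i != j -> gI (star i j) = gI i + gI j.
Proof.
move=> ij; rewrite /star; case: pickP => [k|none] /=.
  by rewrite on_lineE => /andP[_ /eqP].
have n0 : gI i + gI j != 0 by rewrite addg_eq0 (inj_eq gI_inj).
by have [k Hk] := gI_surj n0; have := none k; rewrite on_lineE ij Hk eqxx.
Qed.

Lemma idx_gI (i : I) : idx (gI i) = Some i.
Proof.
rewrite /idx; case: pickP => [j /eqP/gI_inj -> //|none].
by have := none i; rewrite eqxx.
Qed.

Lemma idx0 : idx 0 = None.
Proof. by rewrite /idx; case: pickP => // j; rewrite (negbTE (gI_neq0 j)). Qed.

Lemma collineation_of_additive (s : {perm G}) : additive_perm s ->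
  exists2 t : {perm I}, collineation t & forall i, gI (t i) = s (gI i).
Proof.
move=> Hs; have s0 i : s (gI i) != 0.
  by rewrite -(additive_perm0 Hs) (inj_eq perm_inj) gI_neq0.
have /choice[t Ht] : forall i, exists j, gI j = s (gI i) by move=> i; apply: gI_surj.
have tinj : injective t.
  by move=> i j E; apply: gI_inj; apply: (@perm_inj _ s); rewrite -!Ht E.
exists (perm tinj); last by move=> i; rewrite permE.
move=> i j ij; rewrite !permE; apply: gI_inj.
by rewrite gI_star ?(inj_eq tinj) // !Ht gI_star // Hs.
Qed.

Lemma additive_of_collineation (t : {perm I}) : collineation t ->
  exists2 s : {perm G}, additive_perm s & forall i, gI (t i) = s (gI i).
Proof.
(* [idx] returns [None] at 0 only, so u extends t by sending 0 to 0. *)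
move=> Ht; pose u g := if idx g is Some i then gI (t i) else 0.
have uI i : u (gI i) = gI (t i) by rewrite /u idx_gI.
have u0 : u 0 = 0 by rewrite /u idx0.
have uinj : injective u.
  move=> g h; have [->|/gI_surj[i <-]] := eqVneq g 0.
    have [->|/gI_surj[j <-]] // := eqVneq h 0.
    by rewrite u0 uI => /esym/eqP; rewrite (negbTE (gI_neq0 _)).
  have [->|/gI_surj[j <-]] := eqVneq h 0.
    by rewrite u0 uI => /eqP; rewrite (negbTE (gI_neq0 _)).
  by rewrite !uI => /gI_inj/perm_inj ->.
exists (perm uinj); last by move=> i; rewrite permE uI.
move=> g h; rewrite !permE.
have [->|/gI_surj[i <-]] := eqVneq g 0; first by rewrite u0 !add0r.
have [->|/gI_surj[j <-]] := eqVneq h 0; first by rewrite u0 !addr0.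
have [->|ij] := eqVneq i j; first by rewrite !addgg.
by rewrite -gI_star // !uI Ht // gI_star // (inj_eq perm_inj).
Qed.

(** Admissibility supplies the zeros that [coll_act] puts in degree 0 and on the diagonal. *)
Lemma coll_act_additive (C : fieldType) (eps : G -> G -> C) (t : {perm I}) (s : {perm G}) :
  admissible eps -> additive_perm s -> (forall i, gI (t i) = s (gI i)) ->
  coll_act t eps = fun g h => eps (s g) (s h).
Proof.
move=> adm Hs Ht; apply/funext=> g; apply/funext=> h; rewrite /coll_act.
have [->|/gI_surj[i <-]] := eqVneq g 0.
  by rewrite idx0 additive_perm0 //; have [_ -> _] := adm (s h).
have [->|/gI_surj[j <-]] := eqVneq h 0.
  by rewrite idx0 idx_gI additive_perm0 //; have [_ _ ->] := adm (s (gI i)).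
rewrite !idx_gI !Ht; case: (i =P j) => // ->.
by have [-> _ _] := adm (s (gI j)).
Qed.

Definition supp_set (S : rel G) : {set {set I}} :=
  [set c in X | [exists i : I, exists j : I, (c == [set i; j]) && S (gI i) (gI j)]].

Lemma contraction_supportE (C : fieldType) (eps : G -> G -> C) :
  contraction_support eps = supp_set (supp eps).
Proof. by []. Qed.

Lemma set2_eq (T : finType) (a b c d : T) : [set a; b] = [set c; d] ->
  (a = c /\ b = d) \/ (a = d /\ b = c).
Proof.
move=> E; have Ha : a \in [set c; d] by rewrite -E !inE eqxx.
have Hb : b \in [set c; d] by rewrite -E !inE eqxx orbT.
have Hc : c \in [set a; b] by rewrite E !inE eqxx.
have Hd : d \in [set a; b] by rewrite E !inE eqxx orbT.
move: Ha Hb Hc Hd; rewrite !inE.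
by case/orP=> /eqP->; case/orP=> /eqP->; rewrite ?eqxx ?orbT ?orbF ?orbb;
  do ?[move/eqP=> ?]; subst; auto.
Qed.

Lemma supp_set_pair (S : rel G) (i j : I) : symmetric S ->
  ([set i; j] \in supp_set S) = (i != j) && S (gI i) (gI j).
Proof.
move=> Ssym; rewrite !inE cards2; have [//|ij /=] := eqVneq i j.
apply/existsP/idP => [[i' /existsP[j' /andP[/eqP/set2_eq[] [-> ->] //]]]|H].
  by rewrite Ssym.
by exists i; apply/existsP; exists j; rewrite eqxx.
Qed.

Lemma pairs_eq (T T' : {set {set I}}) : T \subset X -> T' \subset X ->
  (forall i j, i != j -> ([set i; j] \in T) = ([set i; j] \in T')) -> T = T'.
Proof.
move=> /fintype.subsetP TX /fintype.subsetP TX' H; apply/setP=> c.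
apply/idP/idP=> Hc.
  by have := TX _ Hc; move: Hc; rewrite inE => /[swap] /cards2P[i [j [ij ->]]]; rewrite H.
by have := TX' _ Hc; move: Hc; rewrite inE => /[swap] /cards2P[i [j [ij ->]]]; rewrite H.
Qed.

Lemma supp_set_X S : supp_set S \subset X.
Proof. by apply/fintype.subsetP=> c; rewrite inE => /andP[]. Qed.

Lemma eq_supp_set (S S' : rel G) : S =2 S' -> supp_set S = supp_set S'.
Proof. by move=> E; congr supp_set; apply/funext=> g; apply/funext=> h. Qed.

Lemma imset_pair (s : {perm I}) (T : {set {set I}}) (i j : I) :
  ([set s i; s j] \in [set s @: (c : {set I}) | c in T]) = ([set i; j] \in T).
Proof.
have -> : [set s i; s j] = s @: [set i; j] by rewrite imsetU !imset_set1.
by rewrite mem_imset //; apply: imset_inj; apply: perm_inj.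
Qed.

Lemma imset_X (s : {perm I}) (T : {set {set I}}) : T \subset X ->
  [set s @: (c : {set I}) | c in T] \subset X.
Proof.
move=> /fintype.subsetP H; apply/fintype.subsetP => _ /imsetP[c /H Hc ->].
by move: Hc; rewrite !inE card_imset //; apply: perm_inj.
Qed.

Lemma collinear_supp (S S' : rel G) (s : {perm G}) : symmetric S -> symmetric S' ->
  additive_perm s -> (forall g h, S' (s g) (s h) = S g h) ->
  collinear (supp_set S) (supp_set S').
Proof.
move=> Ssym Ssym' Hs H; have [t Ht Et] := collineation_of_additive Hs.
exists t => //; apply: pairs_eq => [||i j ij]; rewrite ?imset_X ?supp_set_X //.
rewrite -(permKV t i) -(permKV t j) imset_pair !supp_set_pair //.
by rewrite !Et H (inj_eq (@perm_inj _ t)).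
Qed.

Lemma supp_collinear (S S' : rel G) : symmetric S -> symmetric S' ->
  (forall g h, S g h -> g != 0 /\ h \notin [:: 0; g]) ->
  (forall g h, S' g h -> g != 0 /\ h \notin [:: 0; g]) ->
  collinear (supp_set S) (supp_set S') ->
  exists2 s, additive_perm s & forall g h, S' (s g) (s h) = S g h.
Proof.
move=> Ssym Ssym' S0 S0' [t Ht E]; have [s Hs Es] := additive_of_collineation Ht.
exists s => // g h.
have S00 (T : rel G) : (forall g h, T g h -> g != 0 /\ h \notin [:: 0; g]) ->
    forall g, [/\ T g g = false, T 0 g = false & T g 0 = false].
  move=> HT k; split; apply/negbTE/negP=> /HT[]; rewrite !inE eqxx ?orbT //.
have [->|/gI_surj[i <-]] := eqVneq g 0.
  by rewrite additive_perm0 //; have [_ -> _] := S00 _ S0 h; have [_ -> _] := S00 _ S0' (s h).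
have [->|/gI_surj[j <-]] := eqVneq h 0.
  by rewrite additive_perm0 //; have [_ _ ->] := S00 _ S0 (gI i);
     have [_ _ ->] := S00 _ S0' (s (gI i)).
have [->|ij] := eqVneq i j.
  by have [-> _ _] := S00 _ S0 (gI j); have [-> _ _] := S00 _ S0' (s (gI j)).
have := imset_pair t (supp_set S) i j; rewrite E !supp_set_pair // (inj_eq perm_inj).
by rewrite ij !Es.
Qed.

Lemma rim_X_upper (S : rel G) (i : I) : symmetric S -> rim_support S (gI i) ->
  supp_set S = X_upper i.
Proof.
move=> Ssym H; apply: pairs_eq; first exact: supp_set_X.
  by apply/fintype.subsetP=> c; rewrite inE => /andP[].
move=> j k jk; rewrite supp_set_pair // jk H /=.
have E : (gI j \notin [:: 0; gI i]) && (gI k == gI i + gI j) = (star j k == i).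
  rewrite -(inj_eq gI_inj) gI_star // !inE (negbTE (gI_neq0 _)) /=.
  apply/andP/eqP => [[_ /eqP->]|<-]; first by rewrite addrCA addgg addr0.
  rewrite addrAC addgg add0r eqxx; split=> //.
  by rewrite -{1}[gI j]addr0 (inj_eq (addrI _)) eq_sym gI_neq0.
rewrite E !inE cards2 jk /=; apply/idP/existsP => [H'|[j' /existsP[k' /andP[/eqP]]]].
  by exists j; apply/existsP; exists k; rewrite eqxx.
have kj : k != j by rewrite eq_sym.
by case/set2_eq=> -[<- <-] //; rewrite -!(inj_eq gI_inj) (gI_star jk) (gI_star kj) addrC.
Qed.

Lemma spoke_X_lower (S : rel G) (i : I) : symmetric S -> spoke_support S (gI i) ->
  supp_set S \subset X_lower i.
Proof.
move=> Ssym [H _]; apply/fintype.subsetP => c Hc.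
have := fintype.subsetP (supp_set_X S) _ Hc; rewrite !inE => /[dup] cX.
case/cards2P=> j [k [jk Ec]]; move: Hc; rewrite Ec supp_set_pair // jk => /= /H.
by rewrite -Ec cX Ec !inE; case=> /gI_inj ->; rewrite eqxx ?orbT.
Qed.

(** Three spokes at i; c = a + b gives [triple_line] and c = i + (a + b) gives [triple_gen]. *)
Definition star3 (i a b c : G) : rel G := fun g h =>
  ((g == i) && (h \in [:: a; b; c])) || ((h == i) && (g \in [:: a; b; c])).

Lemma star3_sym i a b c : symmetric (star3 i a b c).
Proof. by move=> g h; rewrite /star3 orbC. Qed.

Lemma supp_set_star3 (i j k l : I) : i \notin [:: j; k; l] ->
  supp_set (star3 (gI i) (gI j) (gI k) (gI l)) = [set [set i; j]; [set i; k]; [set i; l]].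
Proof.
rewrite !inE !negb_or => /and3P[ij ik il].
have X2 a b : a != b -> [set a; b] \in X by move=> ab; rewrite !inE cards2 ab.
apply: pairs_eq; first exact: supp_set_X.
  by apply/fintype.subsetP=> c; rewrite !inE -orbA => /or3P[] /eqP->; rewrite cards2 ?ij ?ik ?il.
move=> m n mn; rewrite supp_set_pair ?mn; last exact: star3_sym.
rewrite /star3 !inE !(inj_eq gI_inj) /=.
have E a b c d : ([set a; b] == [set c; d] :> {set I}) =
    ((a == c) && (b == d)) || ((a == d) && (b == c)).
  apply/eqP/orP => [/set2_eq[[-> ->]|[-> ->]]|[] /andP[/eqP-> /eqP-> //]].
  - by left; rewrite !eqxx.
  - by right; rewrite !eqxx.
  - by rewrite finset.setUC.
rewrite !E; have [Em|mi] := eqVneq m i; have [En|ni] := eqVneq n i.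
- by rewrite Em En eqxx in mn.
- by rewrite /= !andbF !orbF orbA.
- by rewrite /= !andbT orbA.
- by rewrite /= !andbF.
Qed.

(** * Rescaling *)

Lemma approx_scaling (C : fieldType) (Gam : gradedLieAlgebra C) (eps eps' : G -> G -> C)
    (lam : G -> C) : is_grading Gam -> (forall g, lam g != 0) ->
  (forall g h, eps g h * lam (g + h) = eps' g h * (lam g * lam h)) ->
  approx Gam eps eps'.
Proof.
move=> gr lam0 H; pose F (g : G) (x : Gam) : Gam := lam g *: x.
have lieP := lie_axioms Gam.
have F_lin g : linear (F g).
  by move=> a x y; rewrite /F scalerDr !scalerA mulrC.
have F_inj g : injective (F g) by apply: scalerI.
have F_comp g : (F g @` gla_comp g)%classic = gla_comp ((1 : {perm G})%g g).
  rewrite perm1; apply/seteqP; split=> x.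
    by move=> [y Hy <-]; apply: componentZ.
  move=> Hx; exists ((lam g)^-1 *: x); first exact: componentZ.
  by rewrite /F scalerA divff ?scale1r.
exists (glue F); last by move=> g; rewrite (glue_comp gr F_lin F_comp) perm1.
apply: (glue_iso gr F_lin F_inj F_comp) => g h x y Hx Hy.
by rewrite !perm1 /F (brZl lieP) (brZr lieP) !scalerA H.
Qed.

Section Scaling.
Variables (C : fieldType) (eps eps' : G -> G -> C) (i : G).
Hypothesis sqrt_ex : forall c : C, exists d, d * d = c.
Hypotheses (epsC : forall g h, eps g h = eps h g) (eps'C : forall g h, eps' g h = eps' h g).
Hypothesis i0 : i != 0.

(** The pairs {g, i + g} are disjoint and all sum to i. With [lam i = 1], each only prescribes the
    product [lam g * lam (i + g)], and one square root serves both points. *)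
Lemma rim_scaling : rim_support (supp eps) i -> rim_support (supp eps') i ->
  exists2 lam : G -> C, (forall g, lam g != 0) &
    forall g h, eps g h * lam (g + h) = eps' g h * (lam g * lam h).
Proof.
move=> H H'; have /choice[sq Hsq] := sqrt_ex.
pose lam g := if g \in [:: 0; i] then 1 else sq (eps g (i + g) / eps' g (i + g)).
have nz g : g \notin [:: 0; i] -> eps g (i + g) != 0 /\ eps' g (i + g) != 0.
  move=> Hg; have S : supp eps g (i + g) by rewrite H Hg eqxx.
  by have S' : supp eps' g (i + g) by rewrite H' Hg eqxx.
exists lam => g.
  rewrite /lam; case: ifP => [_|/negbT Hg]; first exact: oner_neq0.
  have [n n'] := nz _ Hg; have : eps g (i + g) / eps' g (i + g) != 0.
    by rewrite mulf_neq0 ?invr_eq0.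
  by apply: contraNneq => E; rewrite -(Hsq (_ / _)) E mul0r.
move=> h; have [/andP[Hg /eqP->]|off] := boolP ((g \notin [:: 0; i]) && (h == i + g));
    last first.
  have Z : supp eps g h = false by rewrite H (negbTE off).
  have Z' : supp eps' g h = false by rewrite H' (negbTE off).
  by rewrite (eqP (negbFE Z)) (eqP (negbFE Z')) !mul0r.
have Hig : i + g \notin [:: 0; i].
  move: Hg; rewrite !inE => /norP[g0 gi]; rewrite negb_or addg_eq0 eq_sym gi.
  by rewrite -{2}(addr0 i) (inj_eq (addrI _)).
have [n n'] := nz _ Hg.
have lam_i : lam i = 1 by rewrite /lam !inE eqxx orbT.
have lam_off k : k \notin [:: 0; i] -> lam k = sq (eps k (i + k) / eps' k (i + k)).
  by rewrite /lam => /negbTE->.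
rewrite addrCA addgg addr0 lam_i mulr1 !lam_off // addgK (epsC (i + g)) (eps'C (i + g)).
by rewrite Hsq mulrC divfK.
Qed.

(** Each line through i gives at most two equations relating [lam g] and [lam (i + g)]. One of these
    values is set to 1 and one equation is solved for the other; a second equation then follows from
    [prod], since [lam i] squares to the inverse of c. *)
Lemma spoke_scaling (c : C) : c != 0 -> (forall g h, supp eps g h = supp eps' g h) ->
  (forall g h, supp eps g h -> g = i \/ h = i) ->
  (forall g, supp eps g i -> g \notin [:: 0; i]) ->
  (forall g, eps' i g * eps' i (i + g) = c * (eps i g * eps i (i + g))) ->
  exists2 lam : G -> C, (forall g, lam g != 0) &
    forall g h, eps g h * lam (g + h) = eps' g h * (lam g * lam h).
Proof.
move=> c0 S spoke S0 prod; have [t Ht] := coset_split i0.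
have [mu Hmu] := sqrt_ex c^-1.
have mu0 : mu != 0 by have := invr_neq0 c0; rewrite -Hmu mulf_eq0 orbb.
(* The functional t marks the point of {g, i + g} that receives 1. The value at the other point g
   solves the equation of the spoke {i, i + g} if present, otherwise that of {i, g}. *)
pose lam g := if g == i then mu else if t g then 1 else
  if supp eps i (i + g) then mu * eps' i (i + g) / eps i (i + g)
  else if supp eps i g then eps i g / (eps' i g * mu) else 1.
have nz g h : supp eps g h -> eps g h != 0 /\ eps' g h != 0.
  by move=> S1; split=> //; have := S1; rewrite S.
suff main g : supp eps i g -> eps i g * lam (i + g) = eps' i g * (mu * lam g).
  exists lam => [g|g h].
    rewrite /lam; case: ifP => // _; case: ifP => _; first exact: oner_neq0.
    case: ifP => [/nz[n n']|_]; first by rewrite !mulf_neq0 ?invr_eq0.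
    case: ifP => [/nz[n n']|_]; last exact: oner_neq0.
    by rewrite !(mulf_neq0, invr_eq0) ?invr_eq0 ?mulf_neq0.
  have lami : lam i = mu by rewrite /lam eqxx.
  have [Sgh|nS] := boolP (supp eps g h); last first.
    have nS' : ~~ supp eps' g h by rewrite -S.
    by rewrite (eqP (negPn nS)) (eqP (negPn nS')) !mul0r.
  have := spoke _ _ Sgh; move: Sgh => /[swap] -[]-> Sgh; first by rewrite lami main.
  by rewrite lami epsC eps'C addrC main ?[_ * mu]mulrC // /supp epsC.
move=> Sg; have [n n'] := nz _ _ Sg.
have gi : g != i.
  have : g \notin [:: 0; i] by apply: S0; rewrite /supp epsC.
  by rewrite !inE negb_or => /andP[].
have g0 : g != 0.
  have : g \notin [:: 0; i] by apply: S0; rewrite /supp epsC.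
  by rewrite !inE negb_or => /andP[].
have igi : (i + g == i) = false.
  by rewrite -{2}(addr0 i) (inj_eq (addrI _)) (negbTE g0).
rewrite /lam igi (negbTE gi) Ht addgK.
case: (t g) => /=; first by rewrite Sg; field.
case: ifP => [S1|_]; last by rewrite Sg; field; rewrite n' mu0.
have [m m'] := nz _ _ S1.
have E := prod g.
rewrite mulr1; transitivity (mu * mu * (eps' i g * eps' i (i + g)) / eps i (i + g)).
  by rewrite Hmu E mulKf // mulfK.
by field.
Qed.
End Scaling.

(** * Equivalent contractions *)

Section Equivalence.
Variables (C : fieldType) (Gam : gradedLieAlgebra C).
Hypothesis Gam_very_good : very_good Gam.
Variables eps eps' : G -> G -> C.
Hypotheses (eps_gc : graded_contraction Gam eps) (eps_adm : admissible eps).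
Hypotheses (eps_gc' : graded_contraction Gam eps') (eps_adm' : admissible eps').
Variables (f : Gam -> Gam) (p : {perm G}).
Hypothesis f_iso : is_lie_iso (contracted_br eps) (contracted_br eps') f.
Hypothesis f_comp : forall g, (f @` gla_comp g)%classic = gla_comp (p g).
Hypothesis p0 : p 0 = 0.

Let Gam_good : good Gam := proj1 Gam_very_good.
Let gr : is_grading Gam := good_grading Gam_good.
Let S := supp eps.
Let S' := supp eps'.
Let S_n0 : forall g h, S g h -> g != 0 /\ h \notin [:: 0; g] := supp_neq0 eps_adm.
Let S'_n0 : forall g h, S' g h -> g != 0 /\ h \notin [:: 0; g] := supp_neq0 eps_adm'.
Let S_sym : symmetric S := supp_sym Gam_good eps_gc eps_adm.
Let S'_sym : symmetric S' := supp_sym Gam_good eps_gc' eps_adm'.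
Let epsC := eps_sym Gam_good eps_gc eps_adm.
Let epsC' := eps_sym Gam_good eps_gc' eps_adm'.
Let pS g h : S' (p g) (p h) = S g h :=
  iso_supp Gam_good eps_adm eps_adm' f_iso f_comp g h.
Let pD g h : S g h -> p (g + h) = p g + p h :=
  @iso_permD _ _ Gam_good _ _ eps_adm _ _ f_iso f_comp g h.

Definition coll_approx : Prop :=
  exists2 s : {perm I}, collineation s & approx Gam (coll_act s eps) eps'.

Lemma agrees_or_rim_or_spoke :
  (exists2 s, additive_perm s & agrees S p s) \/
  (exists i, i != 0 /\ (rim_support S i \/ spoke_support S i)).
Proof.
have [|[i [a [b [Hi ma mb mab conc]]]]] := agrees_or_concurrent S_n0 S_sym p0 pD.
  by left.
right; exists i; split; first by case/and3P: Hi.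
apply: (concurrent_cases S_n0 S_sym _ Hi ma mb mab conc).
by move=> *; apply: (supp_nice Gam_good eps_gc eps_adm); eauto.
Qed.

(** Every pair of S' is the p-image of a pair of S, where s and p coincide. *)
Lemma agrees_supp s : additive_perm s -> agrees S p s ->
  forall g h, S' (s g) (s h) = S g h.
Proof.
move=> Hs Ha g h; apply/idP/idP => H; last by have [-> ->] := Ha g h H; rewrite pS.
have : S (p^-1 (s g))%g (p^-1 (s h))%g by rewrite -pS !permKV.
move=> /[dup] H' /Ha; rewrite !permKV => -[/perm_inj E /perm_inj E'].
by rewrite E E' in H'.
Qed.

(** The automorphism [th] moves degrees by the inverse of s and f moves them by p, so the composite
    preserves a degree wherever p and s agree. The other degrees take no part in a surviving
    bracket, and the identity serves there. *)
Lemma agrees_approx s : additive_perm s -> agrees S p s -> coll_approx.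
Proof.
move=> Hs Ha; have HsV := additive_permV Hs; set t := (s^-1)%g in HsV.
have [th [th_lin th_bij th_br] th_comp] := additive_perm_lift Gam_good
  (proj2 Gam_very_good) HsV.
have [u Hu Eu] := collineation_of_additive HsV; exists u => //.
rewrite (coll_act_additive eps_adm HsV Eu).
(* S is symmetric, so looking at first entries and sums covers every degree of a surviving
   bracket. *)
pose relevant g := `[< exists a b, S a b /\ (g = a \/ g = a + b) >].
have relevantE g : relevant g -> s g = p g.
  move=> /asboolP[a [b [Sab [->|->]]]]; first by case: (Ha _ _ Sab).
  by rewrite Hs pD //; case: (Ha _ _ Sab) => -> ->.
pose F g : Gam -> Gam := if relevant (t g) then f \o th else id.
have [f_lin f_bij _] := f_iso.
have F_lin g : linear (F g).
  by rewrite /F; case: ifP => _ // a x y; rewrite /= th_lin f_lin.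
have F_inj g : injective (F g).
  rewrite /F; case: ifP => _ //.
  by apply: inj_comp; apply: bij_inj.
have F_comp g : (F g @` gla_comp g)%classic = gla_comp ((1 : {perm G})%g g).
  rewrite perm1 /F; case: ifP => [/relevantE E|_]; last by rewrite image_id.
  by rewrite -image_comp th_comp f_comp -E permKV.
exists (glue F); last by move=> g; rewrite (glue_comp gr F_lin F_comp) perm1.
apply: (glue_iso gr F_lin F_inj F_comp) => g h x y Hx Hy; rewrite !perm1.
have tin k v : gla_comp k v -> gla_comp (t k) (th v) by move=> Hv; rewrite -th_comp; exists v.
have [H|nH] := boolP (S (t g) (t h)); last first.
  have nH' : ~~ S' g h by rewrite -(permKV s g) -(permKV s h) agrees_supp.
  by rewrite (eqP (negPn nH)) (eqP (negPn nH')) !scale0r.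
have r1 : relevant (t g) by apply/asboolP; exists (t g), (t h); auto.
have r2 : relevant (t h) by apply/asboolP; exists (t h), (t g); rewrite S_sym; auto.
have r3 : relevant (t (g + h)).
  by apply/asboolP; exists (t g), (t h); rewrite HsV; auto.
rewrite /F r1 r2 r3 /= th_br (iso_hom Gam_good f_iso f_comp (tin _ _ Hx) (tin _ _ Hy)).
by rewrite -!relevantE // !permKV.
Qed.

Lemma scaling_approx s : additive_perm s ->
  (exists2 lam : G -> C, (forall g, lam g != 0) &
    forall g h, eps (s^-1%g g) (s^-1%g h) * lam (g + h) =
      eps' g h * (lam g * lam h)) -> coll_approx.
Proof.
move=> Hs [lam lam0 H]; have HsV := additive_permV Hs.
have [u Hu Eu] := collineation_of_additive HsV; exists u => //.
by rewrite (coll_act_additive eps_adm HsV Eu); apply: approx_scaling gr lam0 H.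
Qed.

Hypothesis sqrt_ex : forall c : C, exists d, d * d = c.

Lemma rim_move i : rim_support S i -> rim_support S' (p i).
Proof.
move=> H g h; rewrite -(permKV p g) -(permKV p h) pS H.
set a := (p^-1 g)%g; set b := (p^-1 h)%g.
rewrite !inE (perm_eq0 p0) (inj_eq perm_inj); apply: andb_id2l => an.
have : S a (i + a) by rewrite H !inE an eqxx.
move=> /pD; rewrite addrCA addgg addr0 => ->.
by rewrite addrAC addgg add0r (inj_eq perm_inj).
Qed.

(** X^(i) is described by addition alone, so any additive s with s i = p i carries it to X^(p i). *)
Lemma rim_frame i : i != 0 -> rim_support S i ->
  exists2 s, additive_perm s & s i = p i /\ forall g h, S' (s g) (s h) = S g h.
Proof.
move=> i0 H; have := i0; rewrite -(perm_eq0 p0) => pi0.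
have ex j : j != 0 -> exists a b, independent3 j a b.
  move=> j0; suff /hasP[a _ Ha] : has (fun a => a \notin [:: 0; j]) enumG.
    by have [b Hb] := independent3_ex j0 Ha; exists a, b.
  by move: {+}j; apply: forallG; vm_compute.
have [a [b Hi]] := ex _ i0; have [a' [b' Hi']] := ex _ pi0.
have [s Hs [Es _ _]] := additive_perm_ex Hi Hi'; exists s => //; split=> // g h.
rewrite (rim_move H) H -Es -Hs (inj_eq perm_inj) !inE (inj_eq perm_inj).
by rewrite (perm_eq0 (additive_perm0 Hs)).
Qed.

Lemma rim_approx i : i != 0 -> rim_support S i -> coll_approx.
Proof.
move=> i0 H; have [s Hs [Es HS]] := rim_frame i0 H; apply: (scaling_approx Hs).
apply: (@rim_scaling _ _ _ (p i)) => //.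
- move=> g h; rewrite -[supp _ g h]/(S (s^-1 g)%g (s^-1 h)%g) -HS !permKV.
  exact: rim_move.
- exact: rim_move.
Qed.

(** The line through i and g carries both of its spokes at i; on such lines the product of the two
    coefficients is nonzero. *)
Definition full_spoke i g : bool := [&& g \notin [:: 0; i], S i g & S i (i + g)].

Section Spoke.
Variable i : G.
Hypotheses (i0 : i != 0) (spoke : spoke_support S i).

(** Each line through i carries a spoke, and p is additive there. *)
Lemma spoke_permD g : p (i + g) = p i + p g.
Proof.
have [|] := boolP (g \in [:: 0; i]).
  by rewrite !inE => /orP[]/eqP->; rewrite ?addgg p0 ?addr0.
move=> /(proj2 spoke) /orP[/pD //|/pD]; rewrite addgK => ->.
by rewrite addgK.
Qed.

Lemma spoke_move g h : S' g h -> g = p i \/ h = p i.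
Proof.
rewrite -(permKV p g) -(permKV p h) pS => /(proj1 spoke) [->|->]; by [left|right].
Qed.

Lemma spoke_move_supp (s : {perm G}) : s i = p i -> (forall g, S' (p i) (s g) = S i g) ->
  forall g h, S' (s g) (s h) = S g h.
Proof.
move=> Es H g h; apply/idP/idP=> H1.
  have [E|E] := spoke_move H1; move: H1.
    have -> : g = i by apply: (@perm_inj _ s); rewrite Es.
    by rewrite Es H.
  have -> : h = i by apply: (@perm_inj _ s); rewrite Es.
  by rewrite S'_sym Es H S_sym.
by have := proj1 spoke _ _ H1; move: H1 => /[swap] -[]-> H1;
  [|rewrite S'_sym]; rewrite Es H // S_sym.
Qed.

Lemma perm_independent3 a b : independent3 i a b -> independent3 (p i) (p a) (p b).
Proof.
move=> /and3P[_ a0 b0]; rewrite /independent3 -spoke_permD !inE !(perm_eq0 p0).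
by rewrite !(inj_eq perm_inj) i0; move: a0 b0; rewrite !inE => -> ->.
Qed.

(** An additive s can follow p on two of the lines through i. On the third, chosen to be the full
    one, it may exchange two points compared with p, which is harmless since both spokes are
    present. *)
Lemma full_spoke_frame g0 : full_spoke i g0 ->
  exists2 s, additive_perm s &
    [/\ s i = p i, forall g, s g = p g \/ s g = p (i + g) &
        forall g h, S' (s g) (s h) = S g h].
Proof.
case/and3P=> g0n Sg Sig.
have [a Ha] := independent3_ex i0 g0n.
have Hi : independent3 i a (a + g0).
  move: Ha; apply/implyP; move: {+}i {+}g0 {+}a {g0n Sg Sig}.
  by apply: (@forallG3 (fun i g0 a => _ ==> _)); vm_compute.
set b := a + g0 in Hi; have Eb : g0 = a + b by rewrite /b addgK.
have [s Hs [Ei Ea Ebb]] := additive_perm_ex Hi (perm_independent3 Hi).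
have Eia : s (i + a) = p (i + a) by rewrite Hs spoke_permD Ei Ea.
have Eib : s (i + b) = p (i + b) by rewrite Hs spoke_permD Ei Ebb.
have E0 : s 0 = p 0 by rewrite p0 additive_perm0.
have known g : g \in [:: 0; i; a; b; i + a; i + b] -> s g = p g.
  by rewrite !inE => /or4P[/eqP->|/eqP->|/eqP->|/or3P[]/eqP->].
have Eg0 : s g0 = p g0 \/ s g0 = p (i + g0).
  set y := (p^-1 (s g0))%g; have Ey : p y = s g0 by rewrite permKV.
  have [/known|ny] := boolP (y \in [:: 0; i; a; b; i + a; i + b]).
    by move=> E; left; move: E; rewrite Ey => /perm_inj yg; rewrite -Ey yg.
  have : y \in [:: g0; i + g0].
    have := span3 y Hi; move: ny; rewrite Eb.
    by rewrite !inE !negb_or => /and5P[/negbTE-> /negbTE-> /negbTE-> /negbTE->]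
      /andP[/negbTE-> /negbTE->].
  by rewrite -Ey !inE => /orP[]/eqP->; auto.
have line g : s g = p g \/ g \in [:: g0; i + g0].
  have [/known|ny] := boolP (g \in [:: 0; i; a; b; i + a; i + b]); first by left.
  right; have := span3 g Hi; move: ny; rewrite Eb.
  by rewrite !inE !negb_or => /and5P[/negbTE-> /negbTE-> /negbTE-> /negbTE->]
    /andP[/negbTE-> /negbTE->].
have alt g : s g = p g \/ s g = p (i + g).
  have [|] := line g; first by left.
  rewrite !inE => /orP[]/eqP->; first exact: Eg0.
  rewrite Hs addgK Ei; case: Eg0 => ->; last by right; rewrite spoke_permD addgK.
  by left; rewrite spoke_permD.
exists s => //; split=> //; apply: spoke_move_supp => // g.
have [->|] := line g; first exact: pS.
have fullp h : h \in [:: g0; i + g0] -> S i h.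
  by rewrite !inE => /orP[]/eqP->.
move=> gl; rewrite fullp //; have igl : i + g \in [:: g0; i + g0].
  by move: gl; rewrite !inE => /orP[]/eqP->; rewrite ?addgK eqxx ?orbT.
by case: (alt g) => ->; rewrite pS fullp.
Qed.

(** These products are the coefficients of the double brackets [x, [x, y]] with x of degree i,
    respectively p i. *)
Let prod_i g := eps i g * eps i (i + g).
Let prod'_i g := eps' (p i) g * eps' (p i) (p i + g).

Hypothesis full_ratio : forall g h, independent3 i g h -> full_spoke i g -> full_spoke i h ->
  prod_i g * prod'_i (p h) = prod'_i (p g) * prod_i h.

(** The constant c is read off on the full line of g0. [full_ratio] transfers it to the other full
    lines, and on the remaining lines both products vanish. *)
Lemma full_spoke_approx g0 : full_spoke i g0 -> coll_approx.
Proof.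
move=> Hg0; have [s Hs [Ei alt HS]] := full_spoke_frame Hg0.
apply: (scaling_approx Hs); pose c := prod'_i (p g0) / prod_i g0.
have full_nz g : full_spoke i g -> prod_i g != 0 /\ prod'_i (p g) != 0.
  case/and3P=> _ H1 H2; split; first by rewrite mulf_neq0.
  by rewrite mulf_neq0 // -?spoke_permD; [move: H1|move: H2]; rewrite -pS.
have [n n'] := full_nz _ Hg0.
apply: (@spoke_scaling _ _ _ (p i) _ _ _ _ c) => //.
- by rewrite (perm_eq0 p0).
- by rewrite mulf_neq0 ?invr_eq0.
- by move=> g h; rewrite -[supp _ g h]/(S (s^-1 g)%g (s^-1 h)%g) -HS !permKV.
- move=> g h; rewrite -[supp _ g h]/(S (s^-1 g)%g (s^-1 h)%g) -HS !permKV.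
  exact: spoke_move.
- move=> g; rewrite -[supp _ g _]/(S (s^-1 g)%g (s^-1 (p i))%g) -HS !permKV.
  by rewrite S'_sym => /S'_n0[].
move=> g; rewrite -{1 2}(permKV s g) -Ei -Hs permK -[RHS]/(c * _).
set x := (s^-1 g)%g; have -> : (s^-1 (s i + g) = i + x)%g.
  by apply: (@perm_inj _ s); rewrite permKV Hs permKV.
rewrite -[_ * _ in RHS]/(c * prod_i x).
(* Even if s x is p (i + x), the product is symmetric in the two points of the line. *)
have -> : eps' (s i) (s x) * eps' (s i) (s (i + x)) = prod'_i (p x).
  rewrite /prod'_i Ei -spoke_permD.
  rewrite Hs Ei; case: (alt x) => ->; first by rewrite -spoke_permD.
  by rewrite -spoke_permD addgK mulrC.
have [fx|nfx] := boolP (full_spoke i x); last first.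
  have S00 : S i x -> S i (i + x) -> full_spoke i x.
    by move=> H1 H2; rewrite /full_spoke H1 H2 !andbT; case: (S_n0 H1).
  have -> : prod_i x = 0.
    apply/eqP; apply: contraNT nfx; rewrite mulf_eq0 negb_or => /andP[H1 H2].
    exact: S00.
  rewrite mulr0; apply/eqP; apply: contraNT nfx.
  rewrite mulf_eq0 negb_or -spoke_permD => /andP[H1 H2].
  by apply: S00; rewrite -pS.
have [|ind] := boolP (x \in [:: g0; i + g0]).
  rewrite !inE => /orP[]/eqP->; rewrite /c ?divfK //.
  rewrite /prod_i /prod'_i spoke_permD !addgK.
  by rewrite mulrC [X in _ = _ * X]mulrC divfK.
have Hind : independent3 i g0 x.
  case/and3P: fx => xn _ _; case/and3P: Hg0 => g0n _ _; rewrite /independent3 i0 g0n.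
  by move: xn ind; rewrite !inE !negb_or => /andP[-> ->].
apply: (mulfI n); rewrite full_ratio // [RHS]mulrA /c.
by rewrite (mulrCA (prod_i g0) (prod'_i (p g0))) divff // mulr1.
Qed.

End Spoke.
Lemma agrees_or_exceptional : (exists2 s, additive_perm s & agrees S p s) \/
  (exists i : I, rim_support S (gI i) \/ spoke_support S (gI i)).
Proof.
have [|[i [i0 H]]] := agrees_or_rim_or_spoke; first by left.
by right; have [j Hj] := gI_surj i0; exists j; rewrite Hj.
Qed.

Lemma non_exceptional_approx :
  ~ (exists i : I, contraction_support eps = X_upper i \/
       contraction_support eps \subset X_lower i) -> coll_approx.
Proof.
move=> H; have [[s Hs Ha]|[i E]] := agrees_or_exceptional.
  exact: agrees_approx Hs Ha.
case: H; exists i; case: E => E; [left|right]; rewrite contraction_supportE.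
  exact: rim_X_upper.
exact: spoke_X_lower.
Qed.

(** No line through i is full, so all products in [spoke_scaling] vanish and c = 1 works;
    collinearity supplies the additive permutation matching the supports. *)
Lemma half_spokes_approx i : i != 0 -> spoke_support S i ->
  (forall g, ~~ full_spoke i g) ->
  collinear (contraction_support eps) (contraction_support eps') -> coll_approx.
Proof.
move=> i0 spoke half /(supp_collinear S_sym S'_sym S_n0 S'_n0)[s Hs HS].
apply: (scaling_approx Hs).
have H1 g h : supp (fun g h => eps (s^-1 g)%g (s^-1 h)%g) g h = S' g h.
  by rewrite -[LHS]/(S (s^-1 g)%g (s^-1 h)%g) -HS !permKV.
have no_full g : S' (p i) g -> S' (p i) (p i + g) -> False.
  rewrite -(permKV p g) -(spoke_permD spoke) !pS => A B.
  have := half (p^-1 g)%g; rewrite /full_spoke A B !andbT.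
  by case: (S_n0 A) => _ ->.
apply: (@spoke_scaling _ _ _ (p i) _ _ _ _ 1) => //.
- by rewrite (perm_eq0 p0).
- exact: oner_neq0.
- by move=> g h; rewrite H1; apply: spoke_move.
- by move=> g; rewrite H1 S'_sym => /S'_n0[].
move=> g; rewrite mul1r; transitivity (0 : C).
  by apply/eqP; apply/negPn/negP; rewrite mulf_eq0 negb_or => /andP[]; apply: no_full.
apply/esym/eqP/negPn/negP; rewrite mulf_eq0 negb_or => /andP[].
by move=> A B; apply: (no_full g); rewrite -H1.
Qed.

(** The points a, b, c lie on the three different lines through i, and each line carries only one
    spoke. *)
Lemma spoke_star3 i a b c : independent3 i a b -> c \in [:: a + b; i + (a + b)] ->
  spoke_support S i -> (forall g, ~~ full_spoke i g) -> S i a -> S i b -> S i c ->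
  S =2 star3 i a b c.
Proof.
move=> Hi Hc spoke half Sa Sb Sc.
have excl g : S i g -> S i (i + g) = false.
  move=> Sg; have := half g; rewrite /full_spoke Sg /=.
  by case: (S_n0 Sg) => _ -> /= /negbTE.
have main h : S i h = (h \in [:: a; b; c]).
  apply/idP/idP => [Sh|]; last by rewrite !inE => /or3P[]/eqP->.
  have Eh : S i (i + h) = false by apply: excl.
  case: (S_n0 Sh) => _; rewrite !inE => /norP[h0 hi].
  have := span3 h Hi; rewrite !inE (negbTE h0) (negbTE hi) /=.
  case/or4P=> [->|->|/eqP E|]; rewrite ?orbT //.
    by move: Eh; rewrite E addgK Sa.
  case/or3P=> [/eqP E|/eqP E|/eqP E]; first by move: Eh; rewrite E addgK Sb.
    move: Hc Sc Eh; rewrite !inE E => /orP[/eqP->|/eqP-> ->] //.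
    by rewrite eqxx !orbT.
  move: Hc Sc Eh; rewrite !inE E addgK => /orP[/eqP-> ->|/eqP->] //.
  by rewrite eqxx !orbT.
move=> g h; apply/idP/orP => [Sgh|].
  have := proj1 spoke _ _ Sgh; move: Sgh => /[swap] -[]->; rewrite ?(S_sym _ i) main;
    by [left; rewrite eqxx|right; rewrite eqxx].
by case=> /andP[/eqP-> H]; rewrite ?(S_sym _ i) main.
Qed.

Lemma half_spokes_frame i : i != 0 -> spoke_support S i ->
  (forall g, ~~ full_spoke i g) ->
  exists a b c, [/\ independent3 i a b, c \in [:: a + b; i + (a + b)] &
    S =2 star3 i a b c].
Proof.
move=> i0 spoke half.
have pick g : g \notin [:: 0; i] -> exists2 h, h \in [:: g; i + g] & S i h.
  by move/(proj2 spoke)/orP => [H|H]; [exists g|exists (i + g)];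
    rewrite // !inE eqxx ?orbT.
have [a0 a0n] : exists a, a \notin [:: 0; i].
  suff /hasP[a _ Ha] : has (fun a => a \notin [:: 0; i]) enumG by exists a.
  by move: {+}i; apply: forallG; vm_compute.
have [a _ Sa] := pick _ a0n; have [_ an] := S_n0 Sa.
have [b0 Hb0] := independent3_ex i0 an.
have [|b bb0 Sb] := pick b0; first by case/and3P: (independent3_swap Hb0).
have Hi : independent3 i a b.
  move: bb0; apply/implyP; move: Hb0; apply/implyP; move: {+}i {+}a {+}b0 {+}b.
  by apply: (@forallG4 (fun i a b0 b => _ ==> _)); vm_compute.
have [|c Hc Sc] := pick (a + b).
  move: Hi; apply/implyP; move: {+}i {+}a {+}b.
  by apply: (@forallG3 (fun i a b => _ ==> _)); vm_compute.
by exists a, b, c; split=> //; apply: spoke_star3.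
Qed.

Lemma star3_perm (s : {perm G}) i a b c g h :
  star3 (s i) (s a) (s b) (s c) (s g) (s h) = star3 i a b c g h.
Proof. by rewrite /star3 !inE !(inj_eq perm_inj). Qed.

(** Let s be additive and equal to p on i, a, b. Then p c is one of two points on the third line
    through p i: if it is s c, then s matches the supports, and otherwise the image is a star of the
    other type. *)
Lemma half_spokes_images i : i != 0 -> spoke_support S i ->
  (forall g, ~~ full_spoke i g) ->
  (exists2 s, additive_perm s & forall g h, S' (s g) (s h) = S g h) \/
  exists a b c c', [/\ independent3 i a b,
    (c, c') \in [:: (a + b, i + (a + b)); (i + (a + b), a + b)],
    S =2 star3 i a b c &
    exists2 s, additive_perm s & forall g h, S' (s g) (s h) = star3 i a b c' g h].
Proof.
move=> i0 spoke half; have [a [b [c [Hi Hc HS]]]] := half_spokes_frame i0 spoke half.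
have [s Hs [Ei Ea Eb]] := additive_perm_ex Hi (perm_independent3 i0 spoke Hi).
have HS' g h : S' g h = star3 (s i) (s a) (s b) (p c) g h.
  by rewrite -(permKV p g) -(permKV p h) pS HS Ei Ea Eb star3_perm.
have Epc : p c = s (a + b) \/ p c = s (i + (a + b)).
  set y := (s^-1 (p c))%g; have Ey : s y = p c by rewrite permKV.
  have Eia : s (i + a) = p (i + a) by rewrite Hs spoke_permD // Ei Ea.
  have Eib : s (i + b) = p (i + b) by rewrite Hs spoke_permD // Ei Eb.
  have E0 : s 0 = p 0 by rewrite p0 additive_perm0.
  (* On the first two lines s = p, and c lies on neither, so injectivity keeps p c off their
     images. *)
  have no d : d \in [:: 0; i; a; b; i + a; i + b] -> y != d.
    move=> dn; apply/eqP=> E; have : p c = p d.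
      rewrite -Ey E; move: dn {E}; rewrite !inE.
      by case/or4P=> [/eqP->|/eqP->|/eqP->|/or3P[]/eqP->].
    move/perm_inj=> Ec; move: dn; rewrite -Ec {Ec E}; apply/negP; move: Hc.
    apply/implyP; move: Hi; apply/implyP; move: {+}i {+}a {+}b {+}c.
    by apply: (@forallG4 (fun i a b c => _ ==> _)); vm_compute.
  rewrite -Ey; have := span3 y Hi; rewrite !inE.
  do 4 (case/orP; [by rewrite (negbTE (no _ _)) // !inE eqxx ?orbT|]).
  do 2 (case/orP; [by rewrite (negbTE (no _ _)) // !inE eqxx ?orbT|]).
  by case/orP=> /eqP->; auto.
have eq_case d : p c = s d -> forall g h, S' (s g) (s h) = star3 i a b d g h.
  by move=> E g h; rewrite HS' E star3_perm.
have [Ec|nc] := eqVneq (p c) (s c).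
  by left; exists s => // g h; rewrite (eq_case c) // HS.
right; move: Hc; rewrite !inE => /orP[]/eqP Ec; subst c.
  exists a, b, (a + b), (i + (a + b)); split=> //; first by rewrite !inE eqxx.
  exists s => //; apply: eq_case; case: Epc => // E.
  by rewrite E eqxx in nc.
exists a, b, (i + (a + b)), (a + b); split=> //; first by rewrite !inE eqxx orbT.
exists s => //; apply: eq_case; case: Epc => // E.
by rewrite E eqxx in nc.
Qed.

Lemma supp_set_triples i j k : independent3 (gI i) (gI j) (gI k) ->
  [/\ uniq [:: i; j; k], ~~ on_line i j k,
    triple_line i j k = supp_set (star3 (gI i) (gI j) (gI k) (gI j + gI k)) &
    triple_gen i j k = supp_set (star3 (gI i) (gI j) (gI k) (gI i + (gI j + gI k)))].
Proof.
move=> H; have [ij ik jk sik] : [/\ i != j, i != k, j != k & star i j != k].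
  move/and3P: H => [_]; rewrite !inE !negb_or !(inj_eq gI_inj).
  case/andP=> _ ji /and4P[_ ki kj]; have ij : i != j by rewrite eq_sym.
  by rewrite -gI_star // (inj_eq gI_inj); split; rewrite // eq_sym.
have il : i \notin [:: j; k; star j k] /\ i \notin [:: j; k; star (star i j) k].
  rewrite !inE (negbTE ij) (negbTE ik) -!(inj_eq gI_inj) !gI_star // /=.
  split; move: H; apply: contraTN => /eqP E; move: E;
    move: {+}(gI i) {+}(gI j) {+}(gI k) => x y z /eqP; apply/implyP; move: x y z;
    by apply: (@forallG3 (fun x y z => _ ==> _)); vm_compute.
split.
- by rewrite /= !inE negb_or ij ik jk.
- by rewrite on_lineE ij /= -gI_star // (inj_eq gI_inj) eq_sym.
- by rewrite -gI_star // supp_set_star3; case: il.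
- by rewrite addrA -gI_star // -gI_star // supp_set_star3; case: il.
Qed.

(** Agreement with p, a rim, or a full spoke line each yields an additive permutation matching the
    supports. What remains is one spoke on each line through i, with p changing the type of the
    star. *)
Lemma not_collinear_triples :
  ~ collinear (contraction_support eps) (contraction_support eps') ->
  exists i j k : I,
      [/\ uniq [:: i; j; k], ~~ on_line i j k &
          (contraction_support eps = triple_line i j k /\
           collinear (contraction_support eps') (triple_gen i j k)) \/
          (contraction_support eps = triple_gen i j k /\
           collinear (contraction_support eps') (triple_line i j k))].
Proof.
move=> ncol; rewrite !contraction_supportE in ncol *.
have coll s : additive_perm s -> (forall g h, S' (s g) (s h) = S g h) -> False.
  by move=> Hs H; apply: ncol; apply: collinear_supp Hs H.
have [[s Hs Ha]|[i []]] := agrees_or_exceptional.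
- by case: (coll s Hs); apply: agrees_supp.
- by move=> /(rim_frame (gI_neq0 i)) [s Hs [_ /(coll s Hs)]].
move=> spoke; have i0 := gI_neq0 i.
have half g : ~~ full_spoke (gI i) g.
  apply/negP=> /(full_spoke_frame i0 spoke)[s Hs [_ _]]; exact: coll Hs.
have [[s Hs /(coll s Hs) //]|] := half_spokes_images i0 spoke half.
move=> [a [b [c [c' [Hi Hcc HS [s Hs HS']]]]]].
have [a0 b0] : a != 0 /\ b != 0.
  by move: Hi; rewrite /independent3 !inE !negb_or => /and3P[_ /andP[-> _] /andP[-> _]].
have [j Ej] := gI_surj a0; have [k Ek] := gI_surj b0; subst a b.
have [u nl El Eg] := supp_set_triples Hi; exists i, j, k; split=> //.
have cl d : (forall g h, S' (s g) (s h) = star3 (gI i) (gI j) (gI k) d g h) ->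
    collinear (supp_set S') (supp_set (star3 (gI i) (gI j) (gI k) d)).
  move=> H; apply: (collinear_supp S'_sym (@star3_sym _ _ _ _) (additive_permV Hs)).
  by move=> g h; rewrite -H !permKV.
move: Hcc; rewrite !inE !xpair_eqE => /orP[]/andP[/eqP Ec /eqP Ec']; subst c c'.
  by left; rewrite El Eg; split; [apply: eq_supp_set|apply: cl].
by right; rewrite El Eg; split; [apply: eq_supp_set|apply: cl].
Qed.

Lemma collinear_approx :
  (forall i g h, spoke_support S i -> independent3 i g h ->
    full_spoke i g -> full_spoke i h ->
    eps i g * eps i (i + g) * (eps' (p i) (p h) * eps' (p i) (p i + p h)) =
    eps' (p i) (p g) * eps' (p i) (p i + p g) * (eps i h * eps i (i + h))) ->
  collinear (contraction_support eps) (contraction_support eps') -> coll_approx.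
Proof.
move=> ratio col; have [[s Hs Ha]|[i []]] := agrees_or_exceptional.
- exact: agrees_approx Hs Ha.
- exact: rim_approx (gI_neq0 i).
move=> spoke; have [[g full]|none] := pselect (exists g, full_spoke (gI i) g).
  by apply: (full_spoke_approx (gI_neq0 i) spoke _ full) => *; apply: ratio.
apply: (half_spokes_approx (gI_neq0 i) spoke _ col) => g.
by apply/negP=> full; apply: none; exists g.
Qed.

End Equivalence.

(** * The orthogonal algebras on the octonions *)

Section Octonions.
Variable C : fieldType.

(** The octonion basis reindexed by degree, so that homogeneous maps act on indices by
    translation. *)
Definition oct_g (t : G) : Oct C := \row_(j < 8) (gvec j == t)%:R.

Lemma gvec_inj : injective (fun j : 'I_8 => gvec j).
Proof.
move=> i j /eqP; apply: contraTeq => ij; rewrite -(inj_eq val_inj) /= in ij.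
have H : all (fun m => all (fun n => (m != n) ==> (gvec m != gvec n)) (iota 0 8)) (iota 0 8).
  by vm_compute.
move/allP: H => /(_ i) H; have := H; rewrite mem_iota ltn_ord => /(_ isT) /allP /(_ j).
by rewrite mem_iota ltn_ord => /(_ isT) /implyP /(_ ij).
Qed.

Lemma gvec_surj (t : G) : exists j : 'I_8, gvec j = t.
Proof.
suff /hasP[m] : has (fun m => gvec m == t) (iota 0 8).
  by rewrite mem_iota => /= lt_m /eqP Hm; exists (Ordinal lt_m).
by move: t; apply: forallG; vm_compute.
Qed.

Lemma oct_gE (j : 'I_8) : oct_g (gvec j) = oct_e C j.
Proof. by apply/rowP=> k; rewrite !mxE eqxx (inj_eq gvec_inj) eq_sym. Qed.

Lemma oct_n_g (v : Oct C) (j : 'I_8) : oct_n v (oct_g (gvec j)) = (v : 'rV_8) 0 j.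
Proof.
rewrite /oct_n (bigD1 j) //= mxE eqxx mulr1 big1 ?addr0 // => k kj.
by rewrite mxE (inj_eq gvec_inj) (negbTE kj) mulr0.
Qed.

Lemma oct_n_gg s t : oct_n (oct_g s) (oct_g t) = (s == t)%:R.
Proof. by have [j <-] := gvec_surj t; rewrite oct_n_g mxE eq_sym. Qed.

Lemma oct_n_sym (x y : Oct C) : oct_n x y = oct_n y x.
Proof. by apply: eq_bigr => i _; rewrite mulrC. Qed.

Lemma oct_nZl a (x y : Oct C) : oct_n (a *: x) y = a * oct_n x y.
Proof. by rewrite /oct_n mulr_sumr; apply: eq_bigr => i _; rewrite mxE mulrA. Qed.

Lemma oct_nBl (x y z : Oct C) : oct_n (x - y) z = oct_n x z - oct_n y z.
Proof. by rewrite /oct_n -sumrB; apply: eq_bigr => i _; rewrite !mxE mulrBl. Qed.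

Lemma oct_lfun_ext (f g : 'End(Oct C)) : (forall t, f (oct_g t) = g (oct_g t)) -> f = g.
Proof.
move=> H; apply/lfunP=> v.
have -> : v = \sum_j (v : 'rV_8) 0 j *: oct_e C j by rewrite -row_sum_delta.
rewrite !linear_sum; apply: eq_bigr => j _; rewrite !linearZ /= -oct_gE.
by congr (_ *: _); apply: H.
Qed.

Lemma oct_compE g (v : Oct C) : oct_comp g v <-> exists c, v = c *: oct_g g.
Proof.
split=> [[i [c [<- ->]]]|[c ->]]; first by exists c; rewrite oct_gE.
by have [j <-] := gvec_surj g; exists j, c; rewrite oct_gE.
Qed.

(** The infinitesimal rotation e_s -> e_t, e_t -> -e_s, for s != t. *)
Definition skew_fun (s t : G) (v : Oct C) : Oct C :=
  oct_n v (oct_g s) *: oct_g t - oct_n v (oct_g t) *: oct_g s.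

Lemma skew_fun_linear s t : linear (skew_fun s t).
Proof.
move=> a x y; rewrite /skew_fun !oct_n_linl !scalerDl scalerBr !scalerA.
by rewrite opprD addrACA.
Qed.

HB.instance Definition _ s t :=
  GRing.isLinear.Build C (Oct C) (Oct C) *:%R (skew_fun s t) (skew_fun_linear s t).

Definition skew (s t : G) : 'End(Oct C) := linfun (skew_fun s t).

Lemma skewE s t v : skew s t v = skew_fun s t v.
Proof. by rewrite lfunE. Qed.

Lemma skew_b3 (s t : G) : s != 0 -> t != 0 -> skew s t \in @b3_mem C.
Proof.
move=> s0 t0; apply/andP; split.
  apply/asboolP => x y; rewrite !skewE /skew_fun oct_nBl !oct_nZl.
  rewrite [in RHS]oct_n_sym oct_nBl !oct_nZl !(oct_n_sym (oct_g _)).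
  by rewrite opprB mulrC [X in _ - X]mulrC.
have E0 : gvec (@ord0 7) = 0 by [].
rewrite skewE /skew_fun -oct_gE E0 !oct_n_gg !(eq_sym (0 : G)) (negbTE s0) (negbTE t0).
by rewrite !scale0r subrr.
Qed.

Section Subalgebra.
(** Working with any A between [b3] and [d4] treats both algebras at once. *)
Variable A : lieSubalgebra C.
Hypothesis b3_A : forall f, f \in @b3_mem C -> f \in lsa_mem A.
Hypothesis A_d4 : forall f, f \in lsa_mem A -> f \in @d4_mem C.
Hypothesis two_neq0 : 2%:R != 0 :> C.

Let L := so_graded A.

(** The matrix entry of x from e_t to e_(g + t); for x of degree g these are the only nonzero
    entries. *)
Definition coef (g : G) (x : L) (t : G) : C := oct_n (lsa_val x (oct_g t)) (oct_g (g + t)).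

Lemma coefE g (x : L) t : @gla_comp C L g x -> lsa_val x (oct_g t) = coef g x t *: oct_g (g + t).
Proof.
move=> /(_ t (oct_g t)) H; have /H/oct_compE[c Hc] : oct_comp t (oct_g t).
  by apply/oct_compE; exists 1; rewrite scale1r.
by rewrite /coef Hc oct_nZl oct_n_gg eqxx mulr1.
Qed.

Lemma coef_skew g (x : L) t : coef g x (g + t) = - coef g x t.
Proof.
have /asboolP H := A_d4 (valP x).
by rewrite /coef addgK H oct_n_sym.
Qed.

(** This is xxy - 2 xyx + yxx evaluated on e_t; skew-symmetry makes the square of x act on e_t as
    minus a square. *)
Lemma double_bracketE g h (x y : L) t : @gla_comp C L g x -> @gla_comp C L h y ->
  lsa_val (lie_br x (lie_br x y) : L) (oct_g t) =
    (2%:R * coef g x (h + t) * coef g x t * coef h y (g + t)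
     - (coef g x (h + t) ^+ 2 + coef g x t ^+ 2) * coef h y t) *: oct_g (h + t).
Proof.
move=> Hx Hy; have lvE (u v : L) w : lsa_val (lie_br u v : L) w =
    lsa_val u (lsa_val v w) - lsa_val v (lsa_val u w).
  by rewrite /= /commutator add_lfunE opp_lfunE !comp_lfunE.
have vZ (u : L) a w : lsa_val u (a *: w) = a *: lsa_val u w by rewrite linearZ.
have vB (u : L) v w : lsa_val u (v - w) = lsa_val u v - lsa_val u w by rewrite linearB.
have Ex := coefE _ Hx; have Ey := coefE _ Hy.
have Ez u : lsa_val (lie_br x y : L) (oct_g u) =
    (coef h y u * coef g x (h + u) - coef g x u * coef h y (g + u)) *: oct_g (g + h + u).
  rewrite lvE Ey Ex !vZ Ey Ex !scalerA scalerBl addrA; congr (_ - _ *: oct_g _).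
  by rewrite addrCA addrA.
rewrite lvE Ez Ex !vZ Ez Ex !scalerA.
have -> : g + (g + h + t) = h + t by rewrite -addrA addgK.
have -> : g + h + (g + t) = h + t by rewrite [g + h]addrC -addrA addgK.
rewrite -scalerBl; congr (_ *: _).
have -> : g + h + t = g + (h + t) by rewrite addrA.
have -> : h + (g + t) = g + (h + t) by rewrite addrCA.
rewrite addgK !coef_skew; ring.
Qed.

Lemma so_graded_ext (x y : L) : (forall t, lsa_val x (oct_g t) = lsa_val y (oct_g t)) -> x = y.
Proof. by move=> H; apply: val_inj; apply: oct_lfun_ext. Qed.

Definition skew_elt (s t : G) (s0 : s != 0) (t0 : t != 0) : L :=
  LsaType (b3_A (skew_b3 s0 t0)).

Lemma skew_eltE (s t : G) (s0 : s != 0) (t0 : t != 0) u :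
  lsa_val (skew_elt s0 t0) (oct_g u) = ((u == s)%:R - (u == t)%:R) *: oct_g (s + t + u).
Proof.
rewrite /= skewE /skew_fun !oct_n_gg scalerBl; congr (_ - _).
  by case: eqP => [->|_]; rewrite ?scale0r // addrAC addgg add0r.
by case: eqP => [->|_]; rewrite ?scale0r // -addrA addgg addr0.
Qed.

Lemma comp_of_coef g (x : L) (c : G -> C) :
  (forall u, lsa_val x (oct_g u) = c u *: oct_g (g + u)) ->
  @gla_comp C L g x /\ forall u, coef g x u = c u.
Proof.
move=> H; split=> [u v /oct_compE[a ->]|u].
  by apply/oct_compE; exists (a * c u); rewrite linearZ /= H scalerA.
by rewrite /coef H oct_nZl oct_n_gg eqxx mulr1.
Qed.

Lemma skew_elt_coef g m s (s0 : s != 0) (t0 : m + s != 0) : g = m ->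
  @gla_comp C L g (skew_elt s0 t0) /\
  forall u, coef g (skew_elt s0 t0) u = (u == s)%:R - (u == m + s)%:R.
Proof.
move=> ->; apply: comp_of_coef => u.
by rewrite skew_eltE; congr (_ *: oct_g (_ + _)); rewrite addrCA addgg addr0.
Qed.

Lemma oct_gZ_inj a b t : a *: oct_g t = b *: oct_g t -> a = b.
Proof.
by move/(congr1 (fun v => oct_n v (oct_g t))); rewrite !oct_nZl oct_n_gg eqxx !mulr1.
Qed.

Lemma lsa_valZ a (u : L) w : lsa_val (a *: u) w = a *: lsa_val u w.
Proof. by rewrite /= scale_lfunE. Qed.

Lemma lsa_valN (u : L) w : lsa_val (- u) w = - lsa_val u w.
Proof. by rewrite /= opp_lfunE. Qed.

Lemma lsa_valD (u v : L) w : lsa_val (u + v) w = lsa_val u w + lsa_val v w.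
Proof. by rewrite /= add_lfunE. Qed.

(** Test the hypothesis on the rotation between e_s and e_(m + s), evaluated at e_s: the mixed term
    vanishes because g is neither 0 nor m. *)
Lemma square_sum (g m s : G) (z : L) c c' :
  g != 0 -> m != 0 -> g != m -> s != 0 -> m + s != 0 -> @gla_comp C L g z ->
  (forall y, @gla_comp C L m y -> c *: - y = c' *: lie_br z (lie_br z y)) ->
  c = c' * (coef g z (m + s) ^+ 2 + coef g z s ^+ 2).
Proof.
move=> g0 m0 gm s0 ms0 Hz /(_ (skew_elt s0 ms0)).
have [Hy Ey] := skew_elt_coef s0 ms0 (erefl m).
move=> /(_ Hy) /(congr1 (fun w : L => lsa_val w (oct_g s))).
rewrite !lsa_valZ lsa_valN (double_bracketE s Hz Hy) (coefE s Hy) -scaleNr !scalerA.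
move/oct_gZ_inj; rewrite !Ey !(inj_eq (addIr s)) eqxx (negbTE gm).
have -> : (g + s == s) = false by rewrite -{2}(add0r s) (inj_eq (addIr s)) (negbTE g0).
have -> : (s == m + s) = false by rewrite eq_sym -{2}(add0r s) (inj_eq (addIr s)) (negbTE m0).
rewrite /= => E; apply: oppr_inj; transitivity (c * - (1 - 0)); first by ring.
by rewrite E; ring.
Qed.

Notation gx := ((1, 0, 0) : G).
Notation gy := ((0, 1, 0) : G).
Notation gz := ((0, 0, 1) : G).

(** The element is the sum of the rotations e_gy -> e_(gx + gy) and e_gz -> e_(gx + gz). Translation
    by gy or gz exchanges its four indices with the other four, so in [double_bracketE] the squares
    sum to 1 and the mixed term is 0. *)
Lemma square_elt : exists2 x, @gla_comp C L gx x &
  forall m y, m \in [:: gy; gz] -> @gla_comp C L m y -> lie_br x (lie_br x y) = - y.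
Proof.
have gy0 : gy != 0 by []. have gxy0 : gx + gy != 0 by [].
have gz0 : gz != 0 by []. have gxz0 : gx + gz != 0 by [].
pose c (u : G) : C := (u == gy)%:R - (u == gx + gy)%:R + ((u == gz)%:R - (u == gx + gz)%:R).
have [H1 E1] := skew_elt_coef gy0 gxy0 (erefl gx).
have [H2 E2] := skew_elt_coef gz0 gxz0 (erefl gx).
pose x : L := skew_elt gy0 gxy0 + skew_elt gz0 gxz0.
have [Hx Ex] : @gla_comp C L gx x /\ forall u, coef gx x u = c u.
  apply: comp_of_coef => u; rewrite lsa_valD (coefE u H1) (coefE u H2) -scalerDl.
  by rewrite E1 E2.
exists x => // m y Hm Hy.
(* The four indices where c is nonzero are those whose last two coordinates differ. *)
have c_sq u : c u = 0 /\ u.1.2 = u.2 \/ c u ^+ 2 = 1 /\ u.1.2 <> u.2.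
  pose bs := (u == gy, u == gx + gy, u == gz, u == gx + gz).
  have H : if u.1.2 == u.2 then bs == (false, false, false, false) else
      bs \in [:: (true, false, false, false); (false, true, false, false);
                 (false, false, true, false); (false, false, false, true)].
    by rewrite {}/bs; move: {+}u; apply: forallG; vm_compute.
  move: H; rewrite /bs /c {bs}; case: (u.1.2 =P u.2) => E; [left|right]; split=> //; move: H;
    case: (u == gy); case: (u == gx + gy); case: (u == gz); case: (u == gx + gz) => // _;
    by rewrite ?(subr0, sub0r, add0r, addr0, oppr0, subrr, sqrrN, expr1n).
have c_flip u : c (m + u) ^+ 2 + c u ^+ 2 = 1 /\ c (m + u) * c u = 0.
  have flip : ((m + u).1.2 == (m + u).2) = (u.1.2 != u.2).
    suff : ((m + u).1.2 == (m + u).2) == (u.1.2 != u.2) by move/eqP.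
    move: Hm; apply/implyP; move: {+}m {+}u.
    by apply: (@forallG2 (fun m u => _ ==> _)); vm_compute.
  case: (c_sq u) => -[Ec /eqP Eu]; case: (c_sq (m + u)) => -[Em /eqP];
    rewrite flip Eu // => _; rewrite Ec Em.
    by rewrite mulr0 expr0n addr0.
  by rewrite mul0r expr0n add0r.
apply: so_graded_ext => u; rewrite (double_bracketE u Hx Hy) lsa_valN (coefE u Hy) -scaleNr.
have [S Z] := c_flip u; rewrite !Ex S mul1r; congr (_ *: _).
by rewrite -(mulrA _ (c (m + u))) Z mulr0 mul0r sub0r.
Qed.

(** Two choices of s in [square_sum] for each of gy and gz involve the same four squares. Adding
    them, 2 c1 and 2 c2 are c1' and c2' times one common sum. *)
Lemma octonion_ratio (f : L -> L) c1 c1' c2 c2' :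
  (forall x, @gla_comp C L gx x -> @gla_comp C L gx (f x)) ->
  (f @` @gla_comp C L gy)%classic = gla_comp gy ->
  (f @` @gla_comp C L gz)%classic = gla_comp gz ->
  (forall x, f (- x) = - f x) ->
  (forall x y, @gla_comp C L gx x -> @gla_comp C L gy y ->
    c1 *: f (lie_br x (lie_br x y)) = c1' *: lie_br (f x) (lie_br (f x) (f y))) ->
  (forall x y, @gla_comp C L gx x -> @gla_comp C L gz y ->
    c2 *: f (lie_br x (lie_br x y)) = c2' *: lie_br (f x) (lie_br (f x) (f y))) ->
  c1 * c2' = c1' * c2.
Proof.
move=> fx fy fz fN H1 H2; have [x Hx sq] := square_elt.
set z := f x in H1 H2; have Hz : gla_comp gx z := fx _ Hx.
have K1 y : @gla_comp C L gy y -> c1 *: - y = c1' *: lie_br z (lie_br z y).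
  rewrite -fy => -[y' Hy' <-]; rewrite -H1 // (sq gy) ?fN //.
have K2 y : @gla_comp C L gz y -> c2 *: - y = c2' *: lie_br z (lie_br z y).
  rewrite -fz => -[y' Hy' <-]; rewrite -H2 // (sq gz) ?fN //.
have gx0 : gx != 0 by []. have gy0 : gy != 0 by []. have gz0 : gz != 0 by [].
have gxy : gx != gy by []. have gxz : gx != gz by [].
have gyx0 : gy + gx != 0 by []. have gyz0 : gy + gz != 0 by [].
have gzx0 : gz + gx != 0 by []. have gzy0 : gz + gy != 0 by [].
have Q1 := square_sum gx0 gy0 gxy gx0 gyx0 Hz K1.
have Q2 := square_sum gx0 gy0 gxy gz0 gyz0 Hz K1.
have Q3 := square_sum gx0 gz0 gxz gx0 gzx0 Hz K2.
have Q4 := square_sum gx0 gz0 gxz gy0 gzy0 Hz K2.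
(* The rotations used must fix 1, so the entry at 0 is obtained from index gx by skew-symmetry. *)
have Egx : coef gx z gx = - coef gx z 0 by rewrite -[X in coef _ _ X]addr0 coef_skew.
rewrite [gy + gx]addrC coef_skew Egx !sqrrN in Q1.
rewrite [gz + gx]addrC coef_skew Egx !sqrrN in Q3.
rewrite [gz + gy]addrC in Q4.
move: (coef gx z (gy + gz)) (coef gx z 0) (coef gx z gy) (coef gx z gz) Q1 Q2 Q3 Q4.
move=> a0 a1 a2 a3 Q1 Q2 Q3 Q4; apply: (mulfI two_neq0).
transitivity (c1' * c2' * (a0 ^+ 2 + a1 ^+ 2 + a2 ^+ 2 + a3 ^+ 2)).
  transitivity ((c1 + c1) * c2'); first by ring.
  by rewrite {1}Q1 Q2; ring.
transitivity (c1' * (c2 + c2)); last by ring.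
by rewrite {1}Q3 Q4; ring.
Qed.

End Subalgebra.
End Octonions.

(** * Invariance of the ratios and assembly *)

Lemma iso_double_bracket (C : fieldType) (Gam : gradedLieAlgebra C) (eps eps' : G -> G -> C)
    (f : Gam -> Gam) (p : {perm G}) (x y : Gam) (i g : G) :
  good Gam -> is_lie_iso (contracted_br eps) (contracted_br eps') f ->
  (forall g, (f @` gla_comp g)%classic = gla_comp (p g)) ->
  p (i + g) = p i + p g -> gla_comp i x -> gla_comp g y ->
  (eps i g * eps i (i + g)) *: f (lie_br x (lie_br x y)) =
    (eps' (p i) (p g) * eps' (p i) (p i + p g)) *: lie_br (f x) (lie_br (f x) (f y)).
Proof.
move=> Hgood Hf Hp Ep Hx Hy; have lieP := lie_axioms Gam.
have Hxy := grading_br (good_grading Hgood) Hx Hy.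
have H1 := iso_hom Hgood Hf Hp Hx Hxy; have H2 := iso_hom Hgood Hf Hp Hx Hy.
rewrite -scalerA H1 Ep scalerA [eps i g * _]mulrC -[LHS]scalerA -(brZr lieP) H2.
by rewrite (brZr lieP) scalerA mulrC.
Qed.

(** Automorphisms inducing additive permutations move i, g, h and their p-images to the standard
    basis. The conjugated f then preserves the three basis degrees, and [octonion_ratio] applies. *)
Lemma so_ratio (C : fieldType) (A : lieSubalgebra C) (eps eps' : G -> G -> C)
    (f : so_graded A -> so_graded A) (p : {perm G}) (i g h : G) :
  (forall u, u \in @b3_mem C -> u \in lsa_mem A) ->
  (forall u, u \in lsa_mem A -> u \in @d4_mem C) -> 2%:R != 0 :> C ->
  very_good (so_graded A) -> is_lie_iso (contracted_br eps) (contracted_br eps') f ->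
  (forall g, (f @` gla_comp g)%classic = gla_comp (p g)) ->
  independent3 i g h -> independent3 (p i) (p g) (p h) ->
  p (i + g) = p i + p g -> p (i + h) = p i + p h ->
  eps i g * eps i (i + g) * (eps' (p i) (p h) * eps' (p i) (p i + p h)) =
  eps' (p i) (p g) * eps' (p i) (p i + p g) * (eps i h * eps i (i + h)).
Proof.
move=> b3A Ad4 two0 [Hgood Hweyl] Hf Hp ind ind' Eg Eh.
have [s Hs [sx sy sz]] := frame_ex ind.
have [t Ht [tx ty tz]] := frame_ex ind'.
have [th [thl thb thbr] thc] := additive_perm_lift Hgood Hweyl Hs.
have [th' [thl' thb' thbr'] thc'] := additive_perm_lift Hgood Hweyl (additive_permV Ht).
have flin := lie_iso_linear Hf.
have comp u : ((th' \o f \o th) @` @gla_comp _ (so_graded A) u)%classic =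
    gla_comp (t^-1 (p (s u)))%g.
  by rewrite -image_comp thc -image_comp Hp thc'.
have thin u x : @gla_comp _ (so_graded A) u x -> gla_comp (s u) (th x).
  by move=> Hx; rewrite -thc; exists x.
apply: (@octonion_ratio _ _ b3A Ad4 two0 (th' \o f \o th)).
- move=> x Hx; have : gla_comp (t^-1%g (p (s (1, 0, 0)))) ((th' \o f \o th) x).
    by rewrite -comp; exists x.
  by rewrite sx -tx permK.
- by rewrite comp sy -ty permK.
- by rewrite comp sz -tz permK.
- by move=> x; rewrite -!scaleN1r /= (linear_funZ thl) (linear_funZ flin) (linear_funZ thl').
- move=> x y /thin; rewrite sx => Hx /thin; rewrite sy => Hy.
  rewrite /= !thbr -(linear_funZ thl') (iso_double_bracket Hgood Hf Hp Eg Hx Hy).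
  by rewrite (linear_funZ thl') !thbr'.
- move=> x y /thin; rewrite sx => Hx /thin; rewrite sz => Hy.
  rewrite /= !thbr -(linear_funZ thl') (iso_double_bracket Hgood Hf Hp Eh Hx Hy).
  by rewrite (linear_funZ thl') !thbr'.
Qed.

Theorem proposition3p23 (R : realType) (Gam : gradedLieAlgebra R[i])
    (hGam : very_good Gam) (eps eps' : G -> G -> R[i])
    (heps : graded_contraction Gam eps) (aeps : admissible eps)
    (heps' : graded_contraction Gam eps') (aeps' : admissible eps') :
  (sim Gam eps eps' ->
   ~ (exists i : I, contraction_support eps = X_upper i \/ contraction_support eps \subset X_lower i) ->
   exists2 s : {perm I}, collineation s & approx Gam (coll_act s eps) eps')
  /\
  (Gam = Gamma_b3 R[i] \/ Gam = Gamma_d4 R[i] ->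
   (sim Gam eps eps' -> ~ collinear (contraction_support eps) (contraction_support eps') ->
    exists i j k : I,
      [/\ uniq [:: i; j; k], ~~ on_line i j k &
          (contraction_support eps = triple_line i j k /\
           collinear (contraction_support eps') (triple_gen i j k)) \/
          (contraction_support eps = triple_gen i j k /\
           collinear (contraction_support eps') (triple_line i j k))])
   /\
   (sim Gam eps eps' -> collinear (contraction_support eps) (contraction_support eps') ->
    exists2 s : {perm I}, collineation s & approx Gam (coll_act s eps) eps')).
Proof.
have Hgood := proj1 hGam.
have perm_of (f : Gam -> Gam) : is_lie_iso (contracted_br eps) (contracted_br eps') f ->
    permutes_components f -> exists2 p : {perm G}, p 0 = 0 &
      forall g, (f @` gla_comp g)%classic = gla_comp (p g).
  by move=> [flin fbij _]; apply: (component_perm Hgood).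
split; first by move=> [f Hf /(perm_of f Hf)[p p0 Hp]]; apply: non_exceptional_approx Hp p0.
move=> b3d4; split=> -[f Hf /(perm_of f Hf)[p p0 Hp]].
  exact: not_collinear_triples Hp p0.
have sqrt_ex (c : R[i]) : exists d, d * d = c by exists (sqrtc c); rewrite -expr2 sqr_sqrtc.
apply: (collinear_approx hGam heps aeps heps' aeps' Hf Hp p0 sqrt_ex).
move=> i g h spoke ind fg fh; have i0 : i != 0 by case/and3P: ind.
(* In the spoke case p is additive along the lines through i, hence carries the basis i, g, h to a
   basis, as [so_ratio] requires. *)
have D := spoke_permD hGam aeps Hf Hp p0 spoke.
have ind' := perm_independent3 hGam aeps Hf Hp p0 i0 spoke ind.
have two0 : 2%:R != 0 :> R[i] by rewrite Num.Theory.pnatr_eq0.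
have d4_b3 u : u \in @b3_mem R[i] -> u \in @d4_mem R[i] by case/andP.
by case: b3d4 => E; subst Gam; apply: (so_ratio _ _ two0 hGam Hf Hp ind ind' (D g) (D h)).
Qed.
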